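(* Let $a,b,h,a'',b'',f$ be smooth functions of $(u,v)$ on an open set $D\subset\mathbb{R}^2$, with $f$ nowhere zero, and with $$ah=h_u,\quad a_v=ba''+h,\quad b_v+bb''=0,\quad h_v=b''h,\quad a''_u+aa''=0,\quad h=b''_u+a''b.$$ Consider, for the unknown functions $x,y,z$ of $(u,v)$, the PDE system consisting of the nine equations $$\theta_{uu}=a\theta_u+b\theta_v,\qquad \theta_{uv}=h\theta,\qquad \theta_{vv}=a''\theta_u+b''\theta_v\qquad (\theta\in\{x,y,z\})$$ together with the equation $$(y_uz_v-z_uy_v)x-(x_uz_v-x_vz_u)y+(x_uy_v-x_vy_u)z=f.$$ Let $G$ be the full symmetry group of this system and let $G_1$ be the subgroup of $G$ which acts on the space of the dependent variables $x,y,z$ (that is, whose infinitesimal generators have the form $\phi(x,y,z)\frac{\partial}{\partial x}+\lambda(x,y,z)\frac{\partial}{\partial y}+\psi(x,y,z)\frac{\partial}{\partial z}$). Then the Lie algebra associated to $G_1$ is generated by the vector fields $$Y_1=x\frac{\partial}{\partial x}-z\frac{\partial}{\partial z},\quad Y_2=y\frac{\partial}{\partial y}-z\frac{\partial}{\partial z},\quad Y_3=y\frac{\partial}{\partial x},\quad Y_4=z\frac{\partial}{\partial x},$$ $$Y_5=x\frac{\partial}{\partial y},\quad Y_6=z\frac{\partial}{\partial y},\quad Y_7=x\frac{\partial}{\partial z},\quad Y_8=y\frac{\partial}{\partial z},$$ and thus the Lie subgroup $G_1$ is the unimodular subgroup of the group of centroaffine transformations.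
   Context: The functions $a,b,h,a'',b''$ are five independent names (the double prime is not a derivative); subscripts $u,v$ denote partial derivatives. Symmetry groups: a symmetry group of a PDE system $\Delta_\nu(x,u^{(n)})=0$, $\nu=1,\dots,l$, in independent variables $x=(x^1,\dots,x^p)$ and dependent variables $u=(u^1,\dots,u^q)$ ($u^{(n)}$ denotes all derivatives of orders $0$ to $n$) is a local group of transformations acting on an open subset $M$ of the space of independent and dependent variables that transforms solutions into solutions. Its Lie algebra of infinitesimal generators (infinitesimal symmetries) is determined by the infinitesimal invariance condition: a vector field $X=\sum_i\zeta^i(x,u)\frac{\partial}{\partial x^i}+\sum_\alpha\phi_\alpha(x,u)\frac{\partial}{\partial u^\alpha}$ is an infinitesimal symmetry if $\mathrm{pr}^{(n)}X[\Delta_\nu(x,u^{(n)})]=0$ for all $\nu$ whenever $\Delta(x,u^{(n)})=0$, where $\mathrm{pr}^{(n)}X=X+\sum_\alpha\sum_J\phi_\alpha^J\frac{\partial}{\partial u^\alpha_J}$, the sum being over multi-indices of order $1\le |J|\le n$, and $\phi^J_\alpha=D_J\big(\phi_\alpha-\sum_i\zeta^iu^\alpha_i\big)+\sum_i\zeta^iu^\alpha_{J,i}$ with $D_J$ the total derivative. The full symmetry group is the one generated by all infinitesimal symmetries. The group of centroaffine transformations is the group of invertible linear transformations of $\mathbb{R}^3$ (with coordinates $x,y,z$) fixing the origin; its unimodular subgroup consists of those with determinant $1$. *)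

(* Defs.v *)
From HB Require Import structures.
From mathcomp Require Import all_boot all_order all_algebra.
From mathcomp Require Import all_classical all_reals all_analysis.
Import Order.TTheory GRing.Theory Num.Theory.
Import numFieldNormedType.Exports.

Set Implicit Arguments.
Unset Strict Implicit.
Unset Printing Implicit Defensive.

Local Open Scope classical_set_scope.
Local Open Scope ring_scope.

(* For finite-dimensional V, this is C^k on the open set U: all iterated
   directional derivatives up to order k exist and are continuous on U. *)
Fixpoint Ck (R : realType) (V W : normedModType R) (k : nat) (U : set V)
    (F : V -> W) : Prop :=
  match k with
  | 0 => forall p, U p -> {for p, continuous F}
  | k'.+1 => [/\ forall p, U p -> {for p, continuous F},
                 forall p v, U p -> derivable F p v
               & forall v, Ck k' U ('D_v F)]
  end.

Definition smooth (R : realType) (V W : normedModType R) (U : set V)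
  (F : V -> W) : Prop := forall k, Ck k U F.

(* Partial derivatives of a function of (u, v): index 0 is u, index 1 is v. *)
Definition pd (R : realType) (i : 'I_2) (F : 'rV[R]_2 -> R)
  (w : 'rV[R]_2) : R := 'D_(delta_mx 0 i) F w.

(* total_space R is the space of independent variables (u, v) and dependent
   variables (x, y, z). A vector field is a map X of this space to itself: the
   entries of (X p).1 and (X p).2 are its coefficients zeta^i and phi_al. *)
Notation total_space R := ('rV[R]_2 * 'rV[R]_3)%type.

(* jder j al k l is the jet coordinate standing for the derivative of the
   al-th dependent variable, k times in u and l times in v. Jets carry
   coordinates of all orders; only finitely many enter below. *)
Record jet (R : realType) := Jet {
  jbase : 'rV[R]_2;
  jder : 'I_3 -> nat -> nat -> R }.

Definition jpoint (R : realType) (j : jet R) : total_space R :=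
  (jbase j, \row_al jder j al 0%N 0%N).

Definition d_indep (R : realType) (i : 'I_2) (F : jet R -> R) (j : jet R) : R :=
  derive1 (fun t : R => F (Jet (jbase j + t *: delta_mx 0 i) (jder j))) 0.

Definition d_dep (R : realType) (al : 'I_3) (k l : nat) (F : jet R -> R)
    (j : jet R) : R :=
  derive1 (fun t : R => F (Jet (jbase j) (fun be m n =>
     if [&& be == al, m == k & n == l] then jder j be m n + t
     else jder j be m n))) 0.

(* The coordinate u^al_{J,i}, for the multi-index J = (k, l). *)
Definition jder1 (R : realType) (j : jet R) (al : 'I_3) (k l : nat)
    (i : 'I_2) : R := jder j al (k + (i == 0%R))%N (l + (i == 1%R))%N.

(* Total derivative D_i of a function F depending on jet coordinates of
   order at most n. *)
Definition total_der (R : realType) (n : nat) (i : 'I_2) (F : jet R -> R)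
    (j : jet R) : R :=
  d_indep i F j +
  \sum_(al < 3) \sum_(k < n.+1) \sum_(l < n.+1 | (k + l <= n)%N)
     jder1 j al k l i * d_dep al k l F j.

Section Prolongation.
Variables (R : realType) (n : nat).
Variable X : total_space R -> total_space R.

Definition characteristic (al : 'I_3) (j : jet R) : R :=
  (X (jpoint j)).2 0 al
  - \sum_(i < 2) (X (jpoint j)).1 0 i * jder1 j al 0%N 0%N i.

(* phi_al^J for J = (k, l) with k + l <= n. The characteristic has order 1, so
   each total derivative taken here is applied to a function of order <= n. *)
Definition prolong_coef (al : 'I_3) (k l : nat) (j : jet R) : R :=
  iter k (total_der n 0) (iter l (total_der n 1) (characteristic al)) j
  + \sum_(i < 2) (X (jpoint j)).1 0 i * jder1 j al k l i.

Definition prolong (F : jet R -> R) (j : jet R) : R :=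
  \sum_(i < 2) (X (jpoint j)).1 0 i * d_indep i F j
  + \sum_(al < 3) (X (jpoint j)).2 0 al * d_dep al 0%N 0%N F j
  + \sum_(al < 3) \sum_(k < n.+1) \sum_(l < n.+1 | (1 <= k + l <= n)%N)
      prolong_coef al k l j * d_dep al k l F j.

End Prolongation.

(* X is an infinitesimal symmetry, on the open set M, of the system of order n
   with equations Delta nu = 0. *)
Definition inf_symmetry (R : realType) (n : nat) (I : Type)
    (Delta : I -> jet R -> R) (M : set (total_space R))
    (X : total_space R -> total_space R) : Prop :=
  smooth M X /\
  forall j, M (jpoint j) -> (forall nu, Delta nu j = 0) ->
  forall nu, prolong n X (Delta nu) j = 0.

(* The infinitesimal symmetries acting on the dependent variables only, with
   coefficients that are functions of the dependent variables only. *)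
Definition dep_inf_symmetry (R : realType) (n : nat) (I : Type)
    (Delta : I -> jet R -> R) (M : set (total_space R))
    (X : total_space R -> total_space R) : Prop :=
  inf_symmetry n Delta M X /\
  exists Phi : 'rV[R]_3 -> 'rV[R]_3, forall p, M p -> X p = (0, Phi p.2).

(* q = exp(X) p, along an integral curve contained in M. *)
Definition flows_to (R : realType) (V : normedModType R) (M : set V)
    (X : V -> V) (p q : V) : Prop :=
  exists g : R -> V, [/\ g 0 = p, g 1 = q
    & forall t : R, 0 <= t <= 1 -> M (g t) /\ is_derive t 1 g (X (g t))].

(* The local group of transformations of M generated by a set L of vector
   fields: generated L M U g means that on the open set U, g is a composition
   exp(X_r) o ... o exp(X_1), X_i in L, all these flows being defined where
   needed. Values of g outside U are irrelevant. Time-1 flows suffice when L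
   is stable under real multiples. *)
Inductive generated (R : realType) (V : normedModType R)
    (L : (V -> V) -> Prop) (M U : set V) : (V -> V) -> Prop :=
  | generated_id g : open U -> U `<=` M -> (forall p, U p -> g p = p) ->
      generated L M U g
  | generated_exp X g g' : L X -> generated L M U g ->
      (forall p, U p -> flows_to M X (g p) (g' p)) -> generated L M U g'.

Section System.
Variable R : realType.
Variables a b h a'' b'' f : 'rV[R]_2 -> R.

Inductive equation := Euu of 'I_3 | Euv of 'I_3 | Evv of 'I_3 | Edet.

Definition system (nu : equation) (j : jet R) : R :=
  let w := jbase j in
  let th al := jder j al 0%N 0%N in
  let th_u al := jder j al 1%N 0%N in
  let th_v al := jder j al 0%N 1%N in
  match nu with
  | Euu al => jder j al 2%N 0%N - (a w * th_u al + b w * th_v al)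
  | Euv al => jder j al 1%N 1%N - h w * th al
  | Evv al => jder j al 0%N 2%N - (a'' w * th_u al + b'' w * th_v al)
  | Edet =>
      let x := th 0 in let y := th 1 in let z := th 2 in
      let x_u := th_u 0 in let y_u := th_u 1 in let z_u := th_u 2 in
      let x_v := th_v 0 in let y_v := th_v 1 in let z_v := th_v 2 in
      (y_u * z_v - z_u * y_v) * x - (x_u * z_v - x_v * z_u) * y
      + (x_u * y_v - x_v * y_u) * z - f w
  end.

End System.

Definition vec3 (R : realType) (x y z : R) : 'rV[R]_3 :=
  \row_(i < 3) nth 0 [:: x; y; z] i.

(* Y k is Y_{k+1}, given by its coefficients along d/dx, d/dy, d/dz. *)
Definition Y (R : realType) (k : 'I_8) (th : 'rV[R]_3) : 'rV[R]_3 :=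
  let x := th 0 0 in let y := th 0 1 in let z := th 0 2 in
  nth 0 [:: vec3 x 0 (- z); vec3 0 y (- z); vec3 y 0 0; vec3 z 0 0;
            vec3 0 x 0; vec3 0 z 0; vec3 0 0 x; vec3 0 0 y] k.

Definition centroaffine (R : realType) (g : 'rV[R]_3 -> 'rV[R]_3)
    (A : 'M[R]_3) : Prop :=
  A \in unitmx /\ forall th, g th = th *m A.

Definition unimodular_centroaffine (R : realType)
    (g : 'rV[R]_3 -> 'rV[R]_3) : Prop :=
  exists A : 'M[R]_3, centroaffine g A /\ \det A = 1.

(* Main.v *)
Require Import Defs.
From HB Require Import structures.
From mathcomp Require Import all_boot all_order all_algebra.
From mathcomp Require Import all_classical all_reals all_analysis.
From mathcomp Require Import ring lra.
Import Order.TTheory GRing.Theory Num.Theory.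
Import numFieldNormedType.Exports.

Set Implicit Arguments.
Unset Strict Implicit.
Unset Printing Implicit Defensive.

Local Open Scope classical_set_scope.
Local Open Scope ring_scope.

(* At a point th = (x, y, z) <> 0 the values (u, v) of the first derivatives
   allowed by the system are the pairs with det(th, u, v) = f. The prolongation
   of Phi(x, y, z) applied to the equation for th_uu is D^2 Phi(u, u), and every
   u not parallel to th occurs; hence D^2 Phi = 0, also at th = 0 by continuity,
   and Phi = th A + c locally. The determinant equation then reads
   det(c, u, v) + (tr A) f = 0: replacing v by v + th shows that c is parallel to
   every th of an open set, so c = 0 and tr A = 0. Conversely a field th A with
   tr A = 0 is a symmetry.
   Along the flow of such a field the determinant of three integral curves is
   constant, so flows are linear maps of determinant 1. In the other direction
   SL_3 is generated by transvections, the time-one flows of the fields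
   s th_i d/dth_j with i <> j. *)

(** * Transvections generate the special linear group *)

(** The equation for th_uu sees only the quadratic form of D^2 Phi, hence only the symmetrized
    iterated partial derivatives. That these commute is proved from the situation itself: the pure
    second derivatives vanish, which makes each component of Phi affine along the axes. Phi is
    affine at first only near each point; a single matrix on all of M comes from the connectedness
    of the projection of M to the dependent variables. On the group side a flow is known only along
    integral curves issuing from an open set, possibly far from the origin. Matrix exponentials are
    therefore replaced by a comparison of curves: the constancy of determinants also yields
    uniqueness for the linear equation, and with it one matrix for the whole open set. For the
    fields s th_i d/dth_j the matrix has square zero, so their integral curves are straight
    lines. *)

Definition transvection (R : comUnitRingType) n (i j : 'I_n) (s : R) : 'M[R]_n :=
  1%:M + s *: delta_mx i j.

Inductive transvection_product (R : comUnitRingType) n : 'M[R]_n -> Prop :=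
  | transvection_product1 : transvection_product 1%:M
  | transvection_productM A i j s : transvection_product A -> i != j ->
      transvection_product (A *m transvection i j s).

Section Transvections.
Variables (R : comUnitRingType) (n : nat).
Implicit Types (A B : 'M[R]_n) (i j : 'I_n) (s : R).

Lemma mul_transvectionN i j s : i != j ->
  transvection i j s *m transvection i j (- s) = 1%:M.
Proof.
move=> ij; rewrite /transvection mulmxDl !mulmxDr !mulmx1 !mul1mx.
rewrite -scalemxAl -scalemxAr mul_delta_mx_cond eq_sym (negbTE ij) mulr0n.
by rewrite !scaler0 addr0 scaleNr subrK.
Qed.

(** Transposition exchanges i and j, so the matrix may be taken lower triangular with unit
    diagonal. *)
Lemma det_transvection i j s : i != j -> \det (transvection i j s) = 1.
Proof.
wlog ji : i j / (j < i)%N => [hw ij|ij].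
  move: (ij); rewrite neq_ltn => /orP[ltij|]; last by move=> /hw; exact.
  rewrite -det_tr -(hw j i) 1?eq_sym//; congr (\det _).
  by rewrite /transvection linearD/= linearZ/= trmx_delta tr_scalar_mx.
rewrite det_trig.
  rewrite big1// => k _; rewrite !mxE eqxx.
  by case: eqP => [->|_]; rewrite ?(negbTE ij) /= ?andbF ?mulr0 ?addr0.
apply/is_trig_mxP => k l kl; rewrite !mxE.
rewrite -val_eqE /= ltn_eqF//= mulr0n add0r.
case: eqP => [ki|_]; last by rewrite mulr0.
case: eqP => [lj|_]; last by rewrite mulr0.
by move: kl; rewrite ki lj ltnNge ltnW.
Qed.

Lemma transvection_product_mul A B : transvection_product A ->
  transvection_product B -> transvection_product (A *m B).
Proof.
move=> hA; elim => [|B' i j s _ ih ij]; first by rewrite mulmx1.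
by rewrite mulmxA; exact: transvection_productM.
Qed.

(** Allows a column operation on a matrix before it is shown to be a product; the operation is
    undone by the opposite one. *)
Lemma transvection_product_mulr A i j s : i != j ->
  transvection_product (A *m transvection i j s) -> transvection_product A.
Proof.
move=> ij hA; rewrite -[A]mulmx1 -(mul_transvectionN s ij) mulmxA.
exact: transvection_productM.
Qed.

(** Row indices never meet column indices, so all products of two of the elementary matrices vanish
    and the transvections multiply by adding their off-diagonal parts. *)
Lemma transvection_product_sum (K : Type) (r : K -> R) (f g : K -> 'I_n) ks :
  (forall k l, f k != g l) ->
  transvection_product (1%:M + \sum_(k <- ks) r k *: delta_mx (f k) (g k)).
Proof.
move=> fg; elim: ks => [|k ks ih].
  by rewrite big_nil addr0; exact: transvection_product1.
rewrite big_cons addrCA addrC.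
suff -> : 1%:M + \sum_(k0 <- ks) r k0 *: delta_mx (f k0) (g k0)
    + r k *: delta_mx (f k) (g k) =
    (1%:M + \sum_(k0 <- ks) r k0 *: delta_mx (f k0) (g k0)) *m
    transvection (f k) (g k) (r k).
  exact: transvection_productM.
rewrite /transvection mulmxDr mulmx1; congr (_ + _).
rewrite mulmxDl mul1mx mulmx_suml big1 ?addr0// => l _.
rewrite -scalemxAl -scalemxAr mul_delta_mx_cond eq_sym (negbTE (fg _ _)).
by rewrite mulr0n !scaler0.
Qed.

End Transvections.

Lemma transvection_product_lift0 (R : comUnitRingType) n (A : 'M[R]_n) :
  transvection_product A -> transvection_product (lift0_mx A).
Proof.
elim=> [|B i j s _ ih ij].
  suff -> : lift0_mx 1%:M = 1%:M :> 'M[R]_(1 + n) by exact: transvection_product1.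
  by rewrite /lift0_mx -scalar_mx_block.
suff -> : lift0_mx (B *m transvection i j s) =
    lift0_mx B *m transvection (rshift 1 i) (rshift 1 j) s.
  by apply: transvection_productM => //; rewrite (inj_eq (@rshift_inj _ _)).
have -> : transvection (rshift 1 i) (rshift 1 j) s = lift0_mx (transvection i j s).
  rewrite /transvection /lift0_mx [1%:M]scalar_mx_block.
  have -> : delta_mx (rshift 1 i) (rshift 1 j) =
      block_mx 0 0 0 (delta_mx i j) :> 'M[R]_(1 + n).
    apply/matrixP => k l; rewrite mxE -[k]fintype.splitK -[l]fintype.splitK.
    case: (fintype.split k) => k'; case: (fintype.split l) => l' /=.
    - by rewrite block_mxEul mxE eq_lrshift.
    - by rewrite block_mxEur mxE eq_lrshift.
    - by rewrite block_mxEdl mxE eq_lrshift andbF.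
    - by rewrite block_mxEdr mxE !(inj_eq (@rshift_inj _ _)).
  by rewrite scale_block_mx add_block_mx !scaler0 !addr0.
by rewrite /lift0_mx mulmx_block !mulmx0 !mul0mx !mulmx1 !addr0 !add0r.
Qed.

Section GaussElimination.
Variable F : fieldType.

Lemma transvection_product_block1 n (r : 'rV[F]_n) (c : 'cV[F]_n) :
  transvection_product (block_mx 1%:M r 0 1%:M : 'M[F]_(1 + n)) /\
  transvection_product (block_mx 1%:M 0 c 1%:M : 'M[F]_(1 + n)).
Proof.
split.
  suff -> : block_mx 1%:M r 0 1%:M = 1%:M +
      \sum_(k <- enum 'I_n) r 0 k *: delta_mx (lshift n ord0) (rshift 1 k).
    by apply: transvection_product_sum => k l; rewrite eq_lrshift.
  rewrite big_enum /= {1}[r]row_sum_delta [1%:M in RHS]scalar_mx_block.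
  have -> : \sum_k r 0 k *: delta_mx (lshift n ord0) (rshift 1 k) =
     block_mx 0 (\sum_k r 0 k *: delta_mx 0 k) 0 0 :> 'M[F]_(1 + n).
    apply/matrixP => k l; rewrite summxE -[k]fintype.splitK -[l]fintype.splitK.
    case: (fintype.split k) => k'; case: (fintype.split l) => l' /=;
      rewrite ?(block_mxEul, block_mxEur, block_mxEdl, block_mxEdr) ?summxE ?mxE.
    - by rewrite big1// => i _; rewrite !mxE eq_lrshift andbF mulr0.
    - apply: eq_bigr => i _; rewrite !mxE (inj_eq (@lshift_inj _ _)).
      by rewrite (inj_eq (@rshift_inj _ _)).
    - by rewrite big1// => i _; rewrite !mxE !eq_lrshift andbF mulr0.
    - by rewrite big1// => i _; rewrite !mxE eq_sym eq_lrshift mulr0.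
  by rewrite add_block_mx !addr0 add0r.
suff -> : block_mx 1%:M 0 c 1%:M = 1%:M +
    \sum_(k <- enum 'I_n) c k 0 *: delta_mx (rshift 1 k) (lshift n ord0).
  by apply: transvection_product_sum => k l; rewrite eq_sym eq_lrshift.
rewrite big_enum /= [1%:M in RHS]scalar_mx_block.
have -> : \sum_k c k 0 *: delta_mx (rshift 1 k) (lshift n ord0) =
   block_mx 0 0 c 0 :> 'M[F]_(1 + n).
  apply/matrixP => k l; rewrite summxE -[k]fintype.splitK -[l]fintype.splitK.
  case: (fintype.split k) => k'; case: (fintype.split l) => l' /=;
    rewrite ?(block_mxEul, block_mxEur, block_mxEdl, block_mxEdr) ?summxE ?mxE.
  - by rewrite big1// => i _; rewrite !mxE eq_lrshift mulr0.
  - by rewrite big1// => i _; rewrite !mxE eq_lrshift mulr0.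
  - rewrite (bigD1 k')//= big1 ?addr0 => [|i ik].
      by rewrite !mxE !eqxx (ord1 l') eqxx mulr1.
    by rewrite !mxE (inj_eq (@rshift_inj _ _)) eq_sym (negbTE ik) mulr0.
  - by rewrite big1// => i _; rewrite !mxE [rshift _ l' == _]eq_sym eq_lrshift andbF mulr0.
by rewrite add_block_mx !addr0 add0r.
Qed.

Lemma mxE_mul_transvection n (A : 'M[F]_n) i j s k l :
  (A *m transvection i j s) k l = A k l + s * A k i *+ (l == j).
Proof.
rewrite /transvection mulmxDr mulmx1 -scalemxAr !mxE; congr (_ + _).
rewrite (bigD1 i)//= big1 ?addr0 => [|m mi].
  by rewrite !mxE eqxx /=; case: eqP; rewrite ?mulr1 ?mulr0 ?mulr1n ?mulr0n.
by rewrite !mxE (negbTE mi) mulr0.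
Qed.

(** Gauss elimination by columns, by induction on the size. Sizes 0 and 1 are apart because creating
    a pivot takes a second column. *)
Theorem transvection_product_det1 n (A : 'M[F]_n) :
  \det A = 1 -> transvection_product A.
Proof.
elim: n A => [|[|n] ih] A detA.
- by rewrite (flatmx0 A) -(flatmx0 1%:M); exact: transvection_product1.
- suff -> : A = 1%:M by exact: transvection_product1.
  by apply/matrixP => i j; rewrite !ord1 mxE eqxx -det_mx11.
(* With pivot 1, B is a lower block shear times the lifted Schur complement times an upper block
   shear; the complement has determinant 1. *)
have pivot1 (B : 'M[F]_n.+2) : \det B = 1 -> B 0 0 = 1 -> transvection_product B.
  move=> detB B00; pose B' : 'M[F]_(1 + n.+1) := B.
  pose r := ursubmx B'; pose c := dlsubmx B'.
  have Bul : ulsubmx B' = 1%:M.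
    apply/matrixP => i j; rewrite !ord1 !mxE eqxx -B00; congr (B _ _);
    exact/val_inj.
  have [hr _] := transvection_product_block1 r 0.
  have [_ hc] := transvection_product_block1 0 c.
  have eB : B' = block_mx 1%:M 0 c 1%:M *m lift0_mx (drsubmx B' - c *m r)
      *m block_mx 1%:M r 0 1%:M.
    rewrite -[B' in LHS]submxK Bul -/r -/c /lift0_mx !mulmx_block.
    by rewrite !(mulmx0, mul0mx, mulmx1, mul1mx, addr0, add0r) addrC subrK.
  have h1 : \det (drsubmx B' - c *m r) = 1.
    have := detB; rewrite -[B]/B' {1}eB !det_mulmx /lift0_mx.
    by rewrite !(@det_lblock _ 1 n.+1) (@det_ublock _ 1 n.+1) !(det1, mul1r, mulr1).
  rewrite -[B]/B' eB; apply: transvection_product_mul => //.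
  by apply: transvection_product_mul => //; exact/transvection_product_lift0/ih.
(* The coefficient s is chosen so that the new pivot [B 0 0 + s * B 0 i] is 1. *)
have pivot0 (B : 'M[F]_n.+2) i : \det B = 1 -> i != 0 -> B 0 i != 0 ->
    transvection_product B.
  move=> detB i0 Bi; apply: (transvection_product_mulr (s := (1 - B 0 0) / B 0 i) i0).
  apply: pivot1; first by rewrite det_mulmx detB det_transvection// mulr1.
  by rewrite mxE_mul_transvection eqxx mulr1n divfK// addrC subrK.
have [A01|A01] := eqVneq (A 0 1) 0; last exact: (pivot0 A 1).
have [i /andP[i0 Ai]|hA] := pickP (fun i : 'I_n.+2 => (i != 0) && (A 0 i != 0)).
  exact: (pivot0 A i).
(* Row 0 now vanishes off the diagonal, so [A 0 0] is nonzero because the determinant is. Adding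
   column 0 to column 1 brings back [pivot0]. *)
apply: (transvection_product_mulr (i := 0) (j := 1) (s := 1)) => //.
apply: (pivot0 _ 1) => //; first by rewrite det_mulmx detA det_transvection// mulr1.
rewrite mxE_mul_transvection eqxx mulr1n mul1r A01 add0r.
apply: contraTneq (oner_neq0 F) => A00; rewrite negbK -detA.
rewrite (expand_det_row _ 0) big1// => j _.
have [->|j0] := eqVneq j 0; first by rewrite A00 mul0r.
by have := hA j; rewrite j0 /= => /negbFE/eqP->; rewrite mul0r.
Qed.

End GaussElimination.

(** * Functions with vanishing derivatives *)

Section Calculus.
Variable R : realType.

Lemma is_derive_segment_cst (f : R -> R) (a b : R) : a <= b ->
  (forall t, a <= t <= b -> is_derive t 1 f 0) -> f b = f a.
Proof.
move=> ab df.
have [t||t _] := @MVT_segment R f (fun=> 0) a b ab.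
- by rewrite in_itv /= => /andP[at_ tb]; apply: df; rewrite !ltW.
- apply: derivable_within_continuous => t; rewrite in_itv /= => /df h; by case: h.
- by rewrite mul0r => /eqP; rewrite subr_eq0 => /eqP.
Qed.

Lemma is_derive_ball_cst (f : R -> R) (t : R) :
  (forall s : R, `|s| <= `|t| -> is_derive s 1 f 0) -> f t = f 0.
Proof.
move=> df; have [t0|t0] := leP 0 t.
  apply: is_derive_segment_cst => // s /andP[s0 st].
  by apply: df; rewrite !ger0_norm.
apply/esym/is_derive_segment_cst; first exact: ltW.
by move=> s /andP[ts s0]; apply: df; rewrite !ler0_norm// ?lerN2// ltW.
Qed.

Lemma is_derive_line (V W : normedModType R) (f : V -> W) (x v : V) (t : R) d :
  is_derive (x + t *: v) v f d -> is_derive t 1 (fun s => f (x + s *: v)) d.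
Proof.
suff e : (fun h : R => h^-1 *: (((fun s => f (x + s *: v)) \o shift t) (h *: 1)
    - f (x + t *: v))) =
  (fun h => h^-1 *: ((f \o shift (x + t *: v)) (h *: v) - f (x + t *: v))).
  by move=> [df <-]; split; [rewrite /derivable e|rewrite /derive e].
apply/funext => h /=; congr (_ *: (f _ - _)).
by rewrite [h *: 1]mulr1 scalerDl addrCA.
Qed.

Lemma ball_rowP n (x y : 'rV[R]_n) (r : R) : 0 < r ->
  ball x r y <-> forall i, `|x 0 i - y 0 i| < r.
Proof.
move=> r0; split=> [[_ h] i|h]; first exact: h.
by split=> // i j; rewrite (ord1 i); exact: h.
Qed.

(** A ball of row vectors is a box: the path from x to y that changes one coordinate at a time, with
    vertices [z k], stays inside, and each piece uses one partial derivative. *)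
Lemma partials0_cst n (f : 'rV[R]_n -> R) (x : 'rV[R]_n) (r : R) :
  (forall y : 'rV[R]_n, ball x r y -> forall i, is_derive y (delta_mx 0 i) f 0) ->
  forall y : 'rV[R]_n, ball x r y -> f y = f x.
Proof.
move=> df y xy; have r0 : 0 < r by case: xy.
have /(ball_rowP _ _ r0) {}xy := xy.
pose z (k : nat) : 'rV[R]_n := \row_i (if (i < k)%N then y 0 i else x 0 i).
suff fz k : (k <= n)%N -> f (z k) = f x.
  rewrite -(fz n (leqnn n)); congr f.
  by apply/rowP => i; rewrite !mxE ltn_ord.
elim: k => [_|k ih kn].
  by congr f; apply/rowP => i; rewrite !mxE.
rewrite -(ih (ltnW kn)); pose k' := Ordinal kn; pose d := y 0 k' - x 0 k'.
have zE i t : (z k + t *: delta_mx 0 k') 0 i =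
    if i == k' then x 0 k' + t else z k 0 i.
  rewrite !mxE eqxx /=; case: eqP => [->|_]; last by rewrite mulr0 addr0.
  by rewrite /= ltnn mulr1.
have -> : z k.+1 = z k + d *: delta_mx 0 k'.
  apply/rowP => i; rewrite zE; have [->|ik] := eqVneq i k'.
    by rewrite !mxE /= ltnSn /d addrC subrK.
  by rewrite !mxE ltnS leq_eqVlt; move: ik; rewrite -val_eqE /= => /negbTE ->.
have hd (t : R) : `|t| <= `|d| ->
    is_derive t 1 (fun s => f (z k + s *: delta_mx 0 k')) 0.
  move=> td; apply: is_derive_line; apply: df; apply/ball_rowP => // i.
  rewrite zE; case: eqP => [->|_].
    rewrite opprD addrA subrr sub0r normrN (le_lt_trans td)// distrC.
    exact: xy.
  by rewrite mxE; case: ifP => // _; rewrite subrr normr0.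
have := is_derive_ball_cst hd.
by rewrite scale0r addr0.
Qed.

Lemma is_derive_affine (V W : normedModType R) (f : V -> W) (x v : V) d :
  (forall t : R, f (x + t *: v) = f x + t *: d) -> is_derive x v f d.
Proof.
move=> fE.
have hd : (fun h : R => h^-1 *: ((f \o shift x) (h *: v) - f x)) @ 0^' --> d.
  apply: cvg_near_cst; near=> h.
  rewrite /= [_ + x]addrC fE addrC addKr scalerA mulVf ?scale1r//.
  by near: h; exact: nbhs_dnbhs_neq.
by split; [apply/cvg_ex; exists d|exact: cvg_lim hd].
Unshelve. all: by end_near. Qed.

Lemma affine_line (V : normedModType R) (f : V -> R) (x v : V) (t : R) :
  (forall s : R, `|s| <= `|t| -> derivable f (x + s *: v) v /\
     is_derive (x + s *: v) v ('D_v f) 0) ->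
  f (x + t *: v) = f x + t * 'D_v f x.
Proof.
move=> hf; pose g (s : R) := f (x + s *: v) - s * 'D_v f x.
suff : g t = g 0.
  by rewrite /g mul0r subr0 scale0r addr0 => /eqP; rewrite subr_eq => /eqP.
apply: is_derive_ball_cst => s st.
have /is_derive_line d1 := derivableP (hf s st).1.
have d2 : is_derive s 1 (fun s : R => s * 'D_v f x) ('D_v f x).
  by apply: is_derive_affine => u; rewrite [u *: 1]mulr1 mulrDl.
apply: (is_derive_eq (is_deriveB d1 d2)).
suff -> : 'D_v f (x + s *: v) = 'D_v f x by rewrite subrr.
have -> : 'D_v f (x + s *: v) = 'D_v f (x + 0 *: v); last first.
  by rewrite scale0r addr0.
apply: (@is_derive_ball_cst (fun s => 'D_v f (x + s *: v))).
by move=> u us; exact: (is_derive_line (hf u (le_trans us st)).2).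
Qed.

Lemma partial2_affine n (f : 'rV[R]_n -> R) (x : 'rV[R]_n) (r : R) :
  (forall y : 'rV[R]_n, ball x r y -> forall i, derivable f y (delta_mx 0 i)) ->
  (forall y : 'rV[R]_n, ball x r y -> forall i j,
     is_derive y (delta_mx 0 j) ('D_(delta_mx 0 i) f) 0) ->
  forall y : 'rV[R]_n, ball x r y ->
  f y = f x + \sum_i (y 0 i - x 0 i) * 'D_(delta_mx 0 i) f x.
Proof.
move=> d1 d2 y xy; pose a i := 'D_(delta_mx 0 i) f x.
pose g (y : 'rV[R]_n) := f y - \sum_i y 0 i * a i.
have : g y = g x.
  apply: (@partials0_cst n g x r) => // {xy}y xy k.
  have h1 := derivableP (d1 y xy k).
  have e i : is_derive y (delta_mx 0 k) (fun y : 'rV[R]_n => y 0 i * a i)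
      ((k == i)%:R * a i).
    apply: is_derive_affine => t; rewrite !mxE eqxx [k == i]eq_sym.
    by rewrite -[t *: _]/(t * _) mulrDl mulrA.
  have h2 := is_derive_sum e.
  have -> : g = f - \sum_(i < n) (fun y0 : 'rV_n => y0 0 i * a i).
    by apply/funext => w; rewrite /g fctE /= fct_sumE.
  apply: (is_derive_eq (is_deriveB h1 h2)).
  rewrite (bigD1 k)//= big1 ?addr0 => [|i ik].
    rewrite eqxx mul1r /a.
    have -> : 'D_(delta_mx 0 k) f y = 'D_(delta_mx 0 k) f x; last first.
      by rewrite subrr.
    by apply: (@partials0_cst n ('D_(delta_mx 0 k) f) x r) => // z xz i; exact: d2.
  by rewrite eq_sym (negbTE ik) mul0r.
rewrite /g => /eqP; rewrite subr_eq => /eqP ->.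
rewrite -addrA; congr (_ + _); rewrite addrC -sumrB.
by apply: eq_bigr => i _; rewrite mulrBl.
Qed.

(* Vanishing pure second derivatives make f affine along each axis near x, so
   that the difference quotients of 'D_i f along j and of 'D_j f along i are
   one and the same constant. *)
Lemma derive_comm_pure0 n (f : 'rV[R]_n -> R) (x : 'rV[R]_n) i j :
  (\forall y \near x, forall k, derivable f y (delta_mx 0 k) /\
    is_derive y (delta_mx 0 k) ('D_(delta_mx 0 k) f) 0) ->
  'D_(delta_mx 0 j) ('D_(delta_mx 0 i) f) x =
  'D_(delta_mx 0 i) ('D_(delta_mx 0 j) f) x.
Proof.
have [->//|ij] := eqVneq i j.
move=> /nbhs_ballP[r /= r0 hf].
pose e k : 'rV[R]_n := delta_mx 0 k.
have aff k l (s t : R) : k != l -> `|s| < r -> `|t| < r ->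
    f (x + s *: e k + t *: e l) =
    f (x + s *: e k) + t * 'D_(e l) f (x + s *: e k).
  move=> kl sr tr; apply: affine_line => u ut; apply: hf.
  apply/ball_rowP => // m; rewrite !mxE eqxx /=.
  have [->|mk] := eqVneq m k.
    rewrite (negbTE kl) mulr0 addr0 mulr1 opprD addrA subrr sub0r normrN //.
  rewrite mulr0 addr0 opprD addrA subrr sub0r normrN.
  case: (m == l); last by rewrite mulr0 normr0.
  by rewrite mulr1 (le_lt_trans ut).
(* The value at the corner x + s e_j + t e_i of a rectangle is computed along both routes from x. *)
have comm (s t : R) : `|s| < r -> `|t| < r ->
    t * ('D_(e i) f (x + s *: e j) - 'D_(e i) f x) =
    s * ('D_(e j) f (x + t *: e i) - 'D_(e j) f x).
  move=> sr tr.
  have := aff j i s t; rewrite eq_sym => /(_ ij sr tr).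
  have := aff i j t s ij tr sr.
  rewrite addrAC => ->.
  have n0 : `|0 : R| < r by rewrite normr0.
  have := aff i j 0 s ij n0 sr; have := aff j i 0 t; rewrite eq_sym.
  move=> /(_ ij n0 tr); rewrite !scale0r !addr0 => -> ->.
  by move=> h; rewrite !mulrBr; lra.
have quot k l : k != l -> (forall s t : R, `|s| < r -> `|t| < r ->
    t * ('D_(e k) f (x + s *: e l) - 'D_(e k) f x) =
    s * ('D_(e l) f (x + t *: e k) - 'D_(e l) f x)) ->
  'D_(e l) ('D_(e k) f) x =
    (r / 2)^-1 * ('D_(e l) f (x + (r / 2) *: e k) - 'D_(e l) f x).
  move=> kl ckl; apply: cvg_lim => //; apply: cvg_near_cst; near=> h.
  have h0 : h != 0 by near: h; exact: nbhs_dnbhs_neq.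
  have hr : `|h| < r by near: h; exact: dnbhs0_lt.
  have r2 : r / 2 != 0 by rewrite mulf_neq0 ?gt_eqF// invr_eq0.
  have hr2 : `|r / 2| < r by rewrite ger0_norm ?divr_ge0 ?ltW//; lra.
  apply: (mulfI h0); apply: (mulfI r2).
  rewrite /= (addrC _ x) -[h^-1 *: _]/(h^-1 * _) (mulVKf h0).
  by rewrite ckl// mulrCA mulVKf.
have hr2 : `|r / 2| < r by rewrite ger0_norm ?divr_ge0 ?ltW//; lra.
have r2 : r / 2 != 0 by rewrite mulf_neq0 ?gt_eqF// invr_eq0.
have q1 := quot i j ij comm.
have ji : j != i by rewrite eq_sym.
have q2 := quot j i ji (fun s t sr tr => esym (comm t s tr sr)).
have q12 := mulfI r2 (comm _ _ hr2 hr2).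
exact: etrans q1 (etrans (congr1 _ (esym q12)) (esym q2)).
Unshelve. all: by end_near. Qed.

(** The preimage of any subset of U is open in S, so the level set through x is both open and closed
    in S. *)
Lemma connected_locally_cst (T : topologicalType) (U : Type) (S : set T)
    (g : T -> U) : open S -> connected S ->
  (forall x, S x -> \forall y \near x, g y = g x) ->
  forall x y, S x -> S y -> g x = g y.
Proof.
move=> oS cS hg x y Sx Sy.
have op (P : set U) : open (S `&` g @^-1` P).
  rewrite openE => z [Sz Pz]; apply: filterI; first exact: open_nbhs_nbhs.
  by apply: filterS (hg z Sz) => w /= ->.
suff e : S `&` g @^-1` [set u | u = g x] = S.
  by move: Sy; rewrite -{1}e => -[_ /esym].
apply: cS; first by exists x.
  exists (S `&` g @^-1` [set u | u = g x]) => //.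
  by rewrite setIA setIid.
exists (~` (S `&` g @^-1` (~` [set u | u = g x]))); first exact: open_closedC.
by rewrite setCI setIUr setICr set0U preimage_setC setCK.
Qed.

End Calculus.

(** * Smooth maps *)

Section Smoothness.
Variable R : realType.

Lemma fst_cvg (V W : normedModType R) (p : V * W) : fst @ p --> p.1.
Proof. exact: cvg_fst. Qed.

Lemma snd_cvg (V W : normedModType R) (p : V * W) : snd @ p --> p.2.
Proof. exact: cvg_snd. Qed.

Lemma cvg_line (V : normedModType R) (p v : V) :
  t *: v + p @[t --> (0 : R)] --> p.
Proof.
have e0 : 0 *: v + p = p by rewrite scale0r add0r.
have c1 : t *: v @[t --> (0 : R)] --> 0 *: v by exact: scalel_continuous.
have c2 : (fun=> p) @ (0 : R) --> p by exact: cvg_cst.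
by rewrite -{2}e0; exact: cvgD c1 c2.
Qed.

Lemma near_line (V : normedModType R) (M : set V) (p v : V) :
  open M -> M p -> \forall t \near (0 : R), M (t *: v + p).
Proof. by move=> oM Mp; apply: cvg_line; exact: open_nbhs_nbhs. Qed.

Lemma near_eq_continuous (T U : topologicalType) (f g : T -> U) x :
  (\near x, f x = g x) -> {for x, continuous f} -> {for x, continuous g}.
Proof.
move=> fg cf; suff : g @ x --> g x by [].
rewrite -(nbhs_singleton fg); apply: cvg_trans cf; apply: near_eq_cvg.
by apply: filterS fg => y ->.
Qed.

Lemma Ck_ext (V W : normedModType R) (U : set V) (F G : V -> W) k :
  open U -> (forall p, U p -> F p = G p) -> Ck k U F -> Ck k U G.
Proof.
move=> oU; elim: k F G => [|k ih] F G FG.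
  move=> cF p Up; apply: near_eq_continuous (cF p Up).
  by apply: filterS (open_nbhs_nbhs (conj oU Up)) => q Uq; exact: FG.
move=> [cF dF kF].
have nFG p : U p -> \near p, F p = G p.
  by move=> Up; apply: filterS (open_nbhs_nbhs (conj oU Up)) => q Uq; exact: FG.
split=> [p Up|p v Up|v].
- exact: near_eq_continuous (nFG p Up) (cF p Up).
- exact: near_eq_derivable (nFG p Up) (dF p v Up).
- apply: ih (kF v) => p Up; exact: near_eq_derive (nFG p Up).
Qed.

Lemma smooth_linear (V W : normedModType R) (U : set V) (F : V -> W) :
  linear F -> continuous F -> smooth U F.
Proof.
move=> lF cF k; have dF p v : is_derive p v F (F v).
  by apply: is_derive_affine => t; rewrite addrC lF addrC.
case: k => [|k]; first by move=> p _; exact: cF.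
split=> [p _|p v _|v]; [exact: cF|by case: (dF p v)|].
have -> : 'D_v F = cst (F v) by apply/funext => p; case: (dF p v).
elim: k (F v) => [|k ih] w; first by move=> p _; exact: cst_continuous.
split=> [p _|p u _|u]; [exact: cst_continuous|exact: derivable_cst|].
suff -> : 'D_u (cst w) = cst 0 :> (V -> W) by exact: ih.
by apply/funext => p; rewrite derive_cst.
Qed.

Lemma Ck_coord (V : normedModType R) n (U : set V) (F : V -> 'rV[R]_n) k j :
  open U -> Ck k U F -> Ck k U (fun p => F p 0 j).
Proof.
move=> oU; have cj (F' : V -> 'rV[R]_n) p : {for p, continuous F'} ->
    {for p, continuous (fun q : V => F' q 0 j : R)}.
  move=> cF'; apply: (@continuous_comp _ _ _ F' (fun y : 'rV[R]_n => y 0 j)) => //.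
  exact: coord_continuous.
elim: k F => [|k ih] F; first by move=> cF p Up; apply: cj; exact: cF.
move=> [cF dF kF]; split=> [p Up|p v Up|v].
- by apply: cj; exact: cF.
- by have /derivable_mxP := dF p v Up.
- apply: Ck_ext (ih _ (kF v)) => // p Up.
  by rewrite (derive_mx (dF p v Up)) mxE.
Qed.

Lemma is_derive_snd (V V' W W' : normedModType R) (M : set (V * W))
    (X : V * W -> V' * W') (F : W -> W') p v : open M -> M p ->
  (forall q, M q -> X q = (0, F q.2)) -> derivable X p (0, v) ->
  derivable F p.2 v /\ 'D_(0, v) X p = (0, 'D_v F p.2).
Proof.
move=> oM Mp XE dX.
have near_p : \forall h \near 0^', M (h *: (0, v) + p).
  exact: cvg_within (near_line (0, v) oM Mp).
pose gX (h : R) := h^-1 *: ((X \o shift p) (h *: (0, v)) - X p).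
pose gF (h : R) := h^-1 *: ((F \o shift p.2) (h *: v) - F p.2).
have gE : \forall h \near 0^', gX h = (0, gF h).
  apply: filterS near_p => h Mh.
  rewrite /gX /= !XE//=; congr pair; rewrite /=.
  by rewrite subr0 scaler0.
have cF : gF @ 0^' --> ('D_(0, v) X p).2.
  have : snd \o gX @ 0^' --> ('D_(0, v) X p).2.
    exact: (cvg_comp gX snd dX (@snd_cvg _ _ _)).
  apply: cvg_trans; apply: near_eq_cvg; by apply: filterS gE => h /(congr1 snd).
have c1 : ('D_(0, v) X p).1 = 0.
  have c : fst \o gX @ 0^' --> ('D_(0, v) X p).1.
    exact: (cvg_comp gX fst dX (@fst_cvg _ _ _)).
  apply: (cvg_unique _ c) => //; apply: cvg_near_cst.
  by apply: filterS gE => h /(congr1 fst).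
split; first by apply/cvg_ex; exists ('D_(0, v) X p).2.
rewrite [LHS]surjective_pairing c1; congr pair; apply/esym.
exact: cvg_lim cF.
Qed.

Lemma continuous_snd (V V' W W' : normedModType R) (M : set (V * W))
    (X : V * W -> V' * W') (F : W -> W') p : open M -> M p ->
  (forall q, M q -> X q = (0, F q.2)) -> {for p, continuous X} ->
  {for p.2, continuous F}.
Proof.
case: p => w y oM Mp XE cX.
have c : {for y, continuous (fun y : W => (w, y))}.
  by apply: cvg_pair; [exact: cvg_cst|exact: cvg_id].
have h : {for y, continuous (snd \o (X \o (fun y : W => (w, y))))}.
  apply: continuous_comp; last exact: cvg_snd.
  exact: continuous_comp.
apply: near_eq_continuous h.
have : nbhs y ((fun y : W => (w, y)) @^-1` M) by apply: c; exact: open_nbhs_nbhs.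
by apply: filterS => z Mz /=; rewrite XE.
Qed.

(** Smoothness is given for X on M and wanted for F on the projection. The induction runs because
    the derivative of X along (0, v) has again the form (0, 'D_v F). *)
Lemma Ck_snd (V V' W W' : normedModType R) (M : set (V * W))
    (X : V * W -> V' * W') (F : W -> W') k : open M ->
  (forall p, M p -> X p = (0, F p.2)) -> Ck k M X -> Ck k (snd @` M) F.
Proof.
move=> oM; elim: k X F => [|k ih] X F XE.
  by move=> cX _ [p Mp <-]; exact: continuous_snd oM Mp XE (cX p Mp).
move=> [cX dX kX]; split=> [_ [p Mp <-]|_ v [p Mp <-]|v].
- exact: continuous_snd oM Mp XE (cX p Mp).
- by have [] := is_derive_snd oM Mp XE (dX p (0, v) Mp).
- apply: (ih ('D_(0, v) X)); last exact: kX.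
  move=> p Mp.
  by have [] := is_derive_snd oM Mp XE (dX p (0, v) Mp).
Qed.

End Smoothness.

(** * Prolongation of fields in the dependent variables *)

Section Jets.
Variable R : realType.
Implicit Types (j : jet R) (F G : jet R -> R).

Lemma derive1_affine (f : R -> R) (d : R) :
  (forall t, f t = f 0 + t * d) -> derive1 f 0 = d.
Proof.
move=> fE; rewrite derive1E; have [_ ->//] : is_derive (0 : R) 1 f d.
by apply: is_derive_affine => t; rewrite add0r fE [t *: 1]mulr1.
Qed.

Lemma near_eq_derive1 (f g : R -> R) (t : R) :
  (\forall s \near t, f s = g s) -> derive1 f t = derive1 g t.
Proof. by move=> fg; rewrite !derive1E; exact: near_eq_derive. Qed.

Lemma derive1_line (V W : normedModType R) (f : V -> W) (x v : V) :
  derive1 (fun t => f (t *: v + x)) 0 = 'D_v f x.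
Proof.
rewrite /derive1 /derive; set g := fun h => _; set g' := fun h => _.
suff -> : g = g' by [].
by apply/funext => h; rewrite /g /g' /= addr0 scale0r add0r.
Qed.

Definition indep_shift (i : 'I_2) (t : R) j : jet R :=
  Jet (jbase j + t *: delta_mx 0 i) (jder j).

Definition dep_shift (al : 'I_3) (k l : nat) (t : R) j : jet R :=
  Jet (jbase j) (fun be m n =>
     if [&& be == al, m == k & n == l] then jder j be m n + t
     else jder j be m n).

Lemma jder_dep_shift al k l t j be m n :
  jder (dep_shift al k l t j) be m n =
  jder j be m n + t * [&& be == al, m == k & n == l]%:R.
Proof. by rewrite /=; case: ifP => _; rewrite ?mulr1 ?mulr0 ?addr0. Qed.

Lemma jpoint_indep_shift i t j :
  jpoint (indep_shift i t j) = t *: (delta_mx 0 i, 0) + jpoint j.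
Proof. by rewrite /jpoint /= addrC; congr pair; rewrite /= scaler0 add0r. Qed.

Lemma jpoint_dep_shift al k l t j :
  jpoint (dep_shift al k l t j) =
  t *: (0, ((k == 0%N) && (l == 0%N))%:R *: delta_mx 0 al) + jpoint j.
Proof.
rewrite /jpoint; congr pair; first by rewrite /= scaler0 add0r.
apply/rowP => be; rewrite mxE jder_dep_shift !mxE eqxx [RHS]addrC.
congr (_ + _ * _).
by rewrite /= [0%N == k]eq_sym [0%N == l]eq_sym -natrM mulnb andbC.
Qed.

(** Every equation of the system is affine in each single jet coordinate, so its partial derivatives
    can be read off as slopes. *)
Lemma d_dep_affine al k l F j (d : R) :
  (forall t, F (dep_shift al k l t j) = F j + t * d) -> d_dep al k l F j = d.
Proof.
move=> FE; apply: (@derive1_affine (fun t => F (dep_shift al k l t j))) => t.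
by rewrite [in RHS]FE mul0r addr0.
Qed.

Section Local.
Variable M : set (total_space R).
Hypothesis oM : open M.

(** The form (0, Phi) of the field is known over M only, so functions on jets are compared over M
    only; M is open, hence small shifts of a coordinate stay over it. *)
Lemma d_indep_local i F G j : (forall j, M (jpoint j) -> F j = G j) ->
  M (jpoint j) -> d_indep i F j = d_indep i G j.
Proof.
move=> FG Mj; apply: near_eq_derive1.
apply: filterS (near_line (delta_mx 0 i, 0) oM Mj) => t.
by rewrite -jpoint_indep_shift => /FG.
Qed.

Lemma d_dep_local al k l F G j : (forall j, M (jpoint j) -> F j = G j) ->
  M (jpoint j) -> d_dep al k l F j = d_dep al k l G j.
Proof.
move=> FG Mj; apply: near_eq_derive1.
apply: filterS (near_line
  (0, ((k == 0%N) && (l == 0%N))%:R *: delta_mx 0 al) oM Mj) => t.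
by rewrite -jpoint_dep_shift => /FG.
Qed.

Lemma total_der_local n i F G j : (forall j, M (jpoint j) -> F j = G j) ->
  M (jpoint j) -> total_der n i F j = total_der n i G j.
Proof.
move=> FG Mj; rewrite /total_der (d_indep_local _ FG)//; congr (_ + _).
by do 3![apply: eq_bigr => ? _]; rewrite (d_dep_local _ _ _ FG).
Qed.

End Local.

Lemma big_ord3 (V : nmodType) (F : 'I_3 -> V) :
  \sum_i F i = F 0 + F 1 + F 2.
Proof.
rewrite !big_ord_recl big_ord0 addr0 addrA.
by congr (_ + F _ + F _); exact/val_inj.
Qed.

Lemma forall_ord3 (P : 'I_3 -> Prop) : P 0 -> P 1 -> P 2 -> forall i, P i.
Proof.
move=> P0 P1 P2 [[|[|[|i]]] hi] //; [move: P0|move: P1|move: P2];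
  by congr P; exact/val_inj.
Qed.

Lemma sum_order2 (F : nat -> nat -> R) :
  \sum_(k < 3) \sum_(l < 3 | (k + l <= 2)%N) F k l =
  F 0%N 0%N + F 0%N 1%N + F 0%N 2%N + F 1%N 0%N + F 1%N 1%N + F 2%N 0%N.
Proof.
have e (k : 'I_3) := big_mkcond (fun l : 'I_3 => (k + l <= 2)%N) (fun l : 'I_3 => F k l).
by rewrite big_ord3 !e !big_ord3 /= !addr0 !addrA.
Qed.

Lemma sum_order12 (F : nat -> nat -> R) :
  \sum_(k < 3) \sum_(l < 3 | (1 <= k + l <= 2)%N) F k l =
  F 0%N 1%N + F 0%N 2%N + F 1%N 0%N + F 1%N 1%N + F 2%N 0%N.
Proof.
have e (k : 'I_3) :=
  big_mkcond (fun l : 'I_3 => (1 <= k + l <= 2)%N) (fun l : 'I_3 => F k l).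
by rewrite big_ord3 !e !big_ord3 /= !addr0 !add0r !addrA.
Qed.

Lemma d_indep_cst i F j : (forall t, F (indep_shift i t j) = F j) ->
  d_indep i F j = 0.
Proof.
move=> FE; apply: (@derive1_affine (fun t => F (indep_shift i t j))) => t.
by rewrite !FE mulr0 addr0.
Qed.

Definition dep_coord j : 'rV[R]_3 := (jpoint j).2.

Lemma dep_coord_dep_shift al k l t j : dep_coord (dep_shift al k l t j) =
  t *: (((k == 0%N) && (l == 0%N))%:R *: delta_mx 0 al) + dep_coord j.
Proof. by rewrite /dep_coord jpoint_dep_shift. Qed.

Lemma total_der_dep (phi : 'rV[R]_3 -> R) i j :
  total_der 2 i (phi \o dep_coord) j =
  \sum_be jder1 j be 0 0 i * 'D_(delta_mx 0 be) phi (dep_coord j).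
Proof.
rewrite /total_der d_indep_cst// add0r; apply: eq_bigr => be _.
have d0 k l : ~~ ((k == 0%N) && (l == 0%N)) ->
    d_dep be k l (phi \o dep_coord) j = 0.
  move=> /negbTE kl; apply: d_dep_affine => t.
  by rewrite /= dep_coord_dep_shift kl scale0r scaler0 add0r mulr0 addr0.
rewrite (sum_order2 (fun k l => jder1 j be k l i * d_dep be k l (phi \o dep_coord) j)).
rewrite !(d0 0%N 1%N, d0 0%N 2%N, d0 1%N 0%N, d0 1%N 1%N, d0 2%N 0%N)// !mulr0 !addr0.
congr (_ * _).
rewrite -[LHS]/(derive1 (fun t => phi (dep_coord (dep_shift be 0 0 t j))) 0).
rewrite -derive1_line; congr (derive1 _ 0); apply/funext => t.
by rewrite dep_coord_dep_shift scale1r.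
Qed.

(** Product rule for a sum of terms theta_i psi(theta): the first sum differentiates psi, the second
    raises the order of theta_i. The booleans [i == 0] and [i == 1], read as numbers, form the
    multi-index of theta_i. *)
Lemma total_der_dep2 (psi : 'I_3 -> 'rV[R]_3 -> R) (i i' : 'I_2) j :
  (forall be al, derivable (psi be) (dep_coord j) (delta_mx 0 al)) ->
  total_der 2 i' (fun j => \sum_be jder1 j be 0 0 i * psi be (dep_coord j)) j =
  \sum_al jder1 j al 0 0 i' * (\sum_be jder1 j be 0 0 i *
      'D_(delta_mx 0 al) (psi be) (dep_coord j)) +
  \sum_al jder1 j al (i == 0) (i == 1) i' * psi al (dep_coord j).
Proof.
move=> dpsi; set F := fun j => _.
have i01 : i = 0 \/ i = 1.
  by case: i {F} => [[|[|//]] hi]; [left|right]; exact/val_inj.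
rewrite /total_der d_indep_cst// add0r -big_split; apply: eq_bigr => al _ /=.
rewrite (sum_order2 (fun k l => jder1 j al k l i' * d_dep al k l F j)).
have FE k l t : ~~ ((k == 0%N) && (l == 0%N)) ->
    F (dep_shift al k l t j) =
    F j + t * (((i == 0) == k :> nat) && ((i == 1) == l :> nat))%:R * psi al (dep_coord j).
  move=> /negbTE kl; rewrite /F dep_coord_dep_shift kl scale0r scaler0 add0r.
  under eq_bigr do rewrite /jder1 jder_dep_shift !add0n mulrDl.
  rewrite big_split /= ; congr (_ + _).
  rewrite (bigD1 al)//= big1 ?addr0 ?eqxx// => be /negbTE ->.
  by rewrite mulr0 mul0r.
have d0 k l : ~~ ((k == 0%N) && (l == 0%N)) -> d_dep al k l F j =
    (((i == 0) == k :> nat) && ((i == 1) == l :> nat))%:R * psi al (dep_coord j).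
  by move=> kl; apply: d_dep_affine => t; rewrite FE// mulrA.
rewrite !(d0 0%N 1%N, d0 0%N 2%N, d0 1%N 0%N, d0 1%N 1%N, d0 2%N 0%N)//.
have -> : d_dep al 0 0 F j =
    \sum_be jder1 j be 0 0 i * 'D_(delta_mx 0 al) (psi be) (dep_coord j).
  rewrite -[LHS]/(derive1 (fun t => F (dep_shift al 0 0 t j)) 0) derive1E.
  have dbe be : is_derive (0 : R) 1
      (fun t : R => jder1 j be 0 0 i * psi be (dep_coord j + t *: delta_mx 0 al))
      (jder1 j be 0 0 i * 'D_(delta_mx 0 al) (psi be) (dep_coord j)).
    have := derivableP (dpsi be al); rewrite -{1}[dep_coord j]addr0.
    rewrite -{1}[0](scale0r (delta_mx 0 al)) => /is_derive_line h.
    exact: is_deriveZ h.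
  have [_ h] := is_derive_sum dbe.
  apply: etrans h; congr (derive _ (0 : R) (1 : R)).
  apply/funext => t; rewrite fct_sumE; apply: eq_bigr => be _.
  rewrite dep_coord_dep_shift scale1r addrC; congr (_ * _).
  by rewrite /jder1 jder_dep_shift; case: i01 => ->; rewrite ?andbF /= mulr0 addr0.
rewrite -!addrA; congr (_ + _).
by case: i01 => ->; rewrite /= !(mul0r, mulr0, add0r, addr0, mul1r).
Qed.

End Jets.

Section DependentFields.
Variables (R : realType) (M : set (total_space R)).
Variables (X : total_space R -> total_space R) (Phi : 'rV[R]_3 -> 'rV[R]_3).
Hypothesis oM : open M.
Hypothesis XE : forall p, M p -> X p = (0, Phi p.2).

Definition component (al : 'I_3) (th : 'rV[R]_3) : R := Phi th 0 al.

Definition partial (be al : 'I_3) : 'rV[R]_3 -> R :=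
  'D_(delta_mx 0 be) (component al).

Hypothesis dPhi : forall p, M p -> forall be al ga,
  derivable (partial be al) p.2 (delta_mx 0 ga).

Definition tangent (al : 'I_3) (th : 'rV[R]_3) (p : 'I_3 -> R) : R :=
  \sum_be p be * partial be al th.

(** The second differential of the component al. The vector p goes with the outer differentiation;
    the order matters as long as the derivatives are not known to commute. *)
Definition hessian (al : 'I_3) (th : 'rV[R]_3) (p q : 'I_3 -> R) : R :=
  \sum_ga p ga * \sum_be q be * 'D_(delta_mx 0 ga) (partial be al) th.

Definition jvec (j : jet R) (k l : nat) : 'I_3 -> R := fun al => jder j al k l.

Lemma total_der_characteristic al i j : M (jpoint j) ->
  total_der 2 i (characteristic X al) j =
  tangent al (dep_coord j) (fun be => jder1 j be 0 0 i).
Proof.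
move=> Mj; apply: etrans (total_der_dep (component al) i j).
apply: (total_der_local oM) => // {Mj}j Mj.
rewrite /characteristic XE//= big1 ?subr0// => k _.
by rewrite mxE mul0r.
Qed.

Lemma total_der2_characteristic al (i i' : 'I_2) j : M (jpoint j) ->
  total_der 2 i' (total_der 2 i (characteristic X al)) j =
  hessian al (dep_coord j) (fun be => jder1 j be 0 0 i') (fun be => jder1 j be 0 0 i) +
  tangent al (dep_coord j) (fun be => jder1 j be (i == 0) (i == 1) i').
Proof.
move=> Mj; apply: etrans (total_der_dep2 (psi := partial^~ al) i i' _); last first.
  by move=> be ga; exact: dPhi.
apply: (total_der_local oM) => // {Mj}j Mj.
by rewrite total_der_characteristic.
Qed.

(** Without components along u and v the characteristic is the component of Phi itself, and the
    prolongation coefficients are its total derivatives, given by the chain rule. *)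
Lemma prolong_dep F j : M (jpoint j) ->
  prolong 2 X F j = \sum_al (let th := dep_coord j in
    component al th * d_dep al 0 0 F j +
    tangent al th (jvec j 1 0) * d_dep al 1 0 F j +
    tangent al th (jvec j 0 1) * d_dep al 0 1 F j +
    (hessian al th (jvec j 1 0) (jvec j 1 0) + tangent al th (jvec j 2 0))
      * d_dep al 2 0 F j +
    (hessian al th (jvec j 1 0) (jvec j 0 1) + tangent al th (jvec j 1 1))
      * d_dep al 1 1 F j +
    (hessian al th (jvec j 0 1) (jvec j 0 1) + tangent al th (jvec j 0 2))
      * d_dep al 0 2 F j).
Proof.
move=> Mj; rewrite /prolong big1 ?add0r => [|i _]; last first.
  by rewrite XE// mxE mul0r.
rewrite -big_split; apply: eq_bigr => al _ /=.
rewrite (sum_order12 (fun k l => prolong_coef 2 X al k l j * d_dep al k l F j)).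
have coefE k l : prolong_coef 2 X al k l j =
   iter k (total_der 2 0) (iter l (total_der 2 1) (characteristic X al)) j.
  rewrite /prolong_coef [X in _ + X]big1 ?addr0// => i _.
  by rewrite XE// mxE mul0r.
rewrite !coefE /= !total_der_characteristic// !total_der2_characteristic//.
have -> : (X (jpoint j)).2 0 al = component al (dep_coord j) by rewrite XE.
rewrite /jder1 /= !addn0 !add0n -/(jvec j 1 0) -/(jvec j 0 1) -/(jvec j 1 1)
  -/(jvec j 2 0) -/(jvec j 0 2).
ring.
Qed.

(** Laid out like the determinant equation: x stands for theta, y and z for its derivatives in u and
    v. *)
Definition det3 (x y z : 'I_3 -> R) : R :=
  (y 1 * z 2 - y 2 * z 1) * x 0 - (y 0 * z 2 - y 2 * z 0) * x 1
  + (y 0 * z 1 - y 1 * z 0) * x 2.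

(** Linearity in each slot. It reassembles the sum over jet coordinates in the prolongation of the
    determinant equation into a Leibniz rule. *)
Lemma det3_expand (x y z u v w : 'I_3 -> R) :
  let e (al be : 'I_3) : R := (be == al)%:R in
  \sum_al (u al * det3 (e al) y z + v al * det3 x (e al) z
            + w al * det3 x y (e al)) =
  det3 u y z + det3 x v z + det3 x y w.
Proof.
rewrite /= big_ord3 /det3 /=.
move: (u 0) (u 1) (u 2) (v 0) (v 1) (v 2) (w 0) (w 1) (w 2).
move: (x 0) (x 1) (x 2) (y 0) (y 1) (y 2) (z 0) (z 1) (z 2).
move=> *; ring.
Qed.

Variables a b h a'' b'' f : 'rV[R]_2 -> R.
Let Delta := system a b h a'' b'' f.

Lemma d_dep_Euu al be k l j : d_dep al k l (Delta (Euu be)) j =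
  (be == al)%:R * ([&& 2%N == k & 0%N == l]%:R - (a (jbase j) * [&& 1%N == k & 0%N == l]%:R
     + b (jbase j) * [&& 0%N == k & 1%N == l]%:R)).
Proof.
apply: d_dep_affine => t; rewrite /Delta /system !jder_dep_shift /=.
case: (be == al) => /=; ring.
Qed.

Lemma d_dep_Euv al be k l j : d_dep al k l (Delta (Euv be)) j =
  (be == al)%:R * ([&& 1%N == k & 1%N == l]%:R - h (jbase j) * [&& 0%N == k & 0%N == l]%:R).
Proof.
apply: d_dep_affine => t; rewrite /Delta /system !jder_dep_shift /=.
case: (be == al) => /=; ring.
Qed.

Lemma d_dep_Evv al be k l j : d_dep al k l (Delta (Evv be)) j =
  (be == al)%:R * ([&& 0%N == k & 2%N == l]%:R - (a'' (jbase j) * [&& 1%N == k & 0%N == l]%:R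
     + b'' (jbase j) * [&& 0%N == k & 1%N == l]%:R)).
Proof.
apply: d_dep_affine => t; rewrite /Delta /system !jder_dep_shift /=.
case: (be == al) => /=; ring.
Qed.

Lemma tangentB al th (p : 'I_3 -> R) (c d : R) (q r : 'I_3 -> R) :
  (forall be, p be - (c * q be + d * r be) = 0) ->
  tangent al th p = c * tangent al th q + d * tangent al th r.
Proof.
move=> pE; rewrite /tangent !mulr_sumr -big_split; apply: eq_bigr => be _ /=.
by move: (pE be) => /eqP; rewrite subr_eq0 => /eqP ->; rewrite mulrDl !mulrA.
Qed.

(** The first differential of Phi is linear, so its values at th_uu, th_u and th_v cancel through
    the equation itself; only the second differential survives. *)
Lemma prolong_Euu al j : M (jpoint j) -> (forall nu, Delta nu j = 0) ->
  prolong 2 X (Delta (Euu al)) j =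
  hessian al (dep_coord j) (jvec j 1 0) (jvec j 1 0).
Proof.
move=> Mj sol; rewrite prolong_dep// (bigD1 al)//= big1 ?addr0 => [|be ba].
  rewrite !d_dep_Euu eqxx /= (tangentB al _ (fun be => sol (Euu be))) -/(jvec j 1 0).
  rewrite -/(jvec j 0 1) -/(jvec j 2 0); ring.
by rewrite !d_dep_Euu eq_sym (negbTE ba) !(mul0r, mulr0, addr0).
Qed.

Lemma prolong_Evv al j : M (jpoint j) -> (forall nu, Delta nu j = 0) ->
  prolong 2 X (Delta (Evv al)) j =
  hessian al (dep_coord j) (jvec j 0 1) (jvec j 0 1).
Proof.
move=> Mj sol; rewrite prolong_dep// (bigD1 al)//= big1 ?addr0 => [|be ba].
  rewrite !d_dep_Evv eqxx /= (tangentB al _ (fun be => sol (Evv be))) -/(jvec j 1 0).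
  rewrite -/(jvec j 0 1) -/(jvec j 2 0); ring.
by rewrite !d_dep_Evv eq_sym (negbTE ba) !(mul0r, mulr0, addr0).
Qed.

(** This equation contains th undifferentiated, which leaves the defect in Euler's identity for
    homogeneous functions of degree 1; it vanishes when Phi is linear. *)
Lemma prolong_Euv al j : M (jpoint j) -> (forall nu, Delta nu j = 0) ->
  prolong 2 X (Delta (Euv al)) j =
  hessian al (dep_coord j) (jvec j 1 0) (jvec j 0 1) +
  h (jbase j) * (tangent al (dep_coord j) (jvec j 0 0) - component al (dep_coord j)).
Proof.
move=> Mj sol; rewrite prolong_dep// (bigD1 al)//= big1 ?addr0 => [|be ba].
  have e be : jder j be 1 1 - (h (jbase j) * jder j be 0 0 + 0 * jder j be 0 0) = 0.
    by rewrite mul0r addr0; exact: (sol (Euv be)).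
  rewrite !d_dep_Euv eqxx /= (tangentB al _ e); ring.
by rewrite !d_dep_Euv eq_sym (negbTE ba) !(mul0r, mulr0, addr0).
Qed.

Lemma system_det j : Delta Edet j =
  det3 (jvec j 0 0) (jvec j 1 0) (jvec j 0 1) - f (jbase j).
Proof. by rewrite /Delta /system /det3 /jvec; ring. Qed.

Lemma prolong_Edet j : M (jpoint j) ->
  let th := dep_coord j in
  prolong 2 X (Delta Edet) j =
  det3 (component^~ th) (jvec j 1 0) (jvec j 0 1) +
  det3 (jvec j 0 0) (fun al => tangent al th (jvec j 1 0)) (jvec j 0 1) +
  det3 (jvec j 0 0) (jvec j 1 0) (fun al => tangent al th (jvec j 0 1)).
Proof.
move=> Mj th; rewrite prolong_dep// -/th.
pose e (al be : 'I_3) : R := (be == al)%:R.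
have d00 al : d_dep al 0 0 (Delta Edet) j = det3 (e al) (jvec j 1 0) (jvec j 0 1).
  apply: d_dep_affine => t; rewrite !system_det /det3 /jvec !jder_dep_shift /=.
  by rewrite /e !andbT !andbF /=; ring.
have d10 al : d_dep al 1 0 (Delta Edet) j = det3 (jvec j 0 0) (e al) (jvec j 0 1).
  apply: d_dep_affine => t; rewrite !system_det /det3 /jvec !jder_dep_shift /=.
  by rewrite /e !andbT !andbF /=; ring.
have d01 al : d_dep al 0 1 (Delta Edet) j = det3 (jvec j 0 0) (jvec j 1 0) (e al).
  apply: d_dep_affine => t; rewrite !system_det /det3 /jvec !jder_dep_shift /=.
  by rewrite /e !andbT !andbF /=; ring.
have d2 al k l : (k + l = 2)%N -> d_dep al k l (Delta Edet) j = 0.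
  move=> kl; apply: d_dep_affine => t; rewrite !system_det /det3 /jvec !jder_dep_shift /=.
  move: k l kl => [|[|[|k]]] [|[|[|l]]] //= _; rewrite !andbF /=; ring.
rewrite -det3_expand; apply: eq_bigr => al _.
by rewrite d00 d10 d01 !d2//; cbv zeta; rewrite !mulr0 !addr0.
Qed.

End DependentFields.

(** * Algebra of the determining equations *)

Section Frames.
Variable R : realType.
Implicit Types x y z u v : 'I_3 -> R.

Definition cross x y : 'I_3 -> R := fun i =>
  nth 0 [:: x 1 * y 2 - x 2 * y 1; x 2 * y 0 - x 0 * y 2; x 0 * y 1 - x 1 * y 0] i.

Lemma det3_cross x y z : det3 x y z = \sum_i cross x y i * z i.
Proof. by rewrite big_ord3 /cross /det3 /=; ring. Qed.

(** Supplies the vector v that completes given th and u to first-order data of a jet satisfying the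
    system. *)
Lemma complete_frame x y i (d : R) : cross x y i != 0 ->
  exists z, det3 x y z = d.
Proof.
move=> ci; exists (fun k => if k == i then d / cross x y i else 0).
rewrite det3_cross (bigD1 i)//= big1 ?addr0 ?eqxx => [|k /negbTE ->].
  by rewrite mulrCA mulfV ?mulr1.
by rewrite mulr0.
Qed.

Lemma exists_cross_neq0 x i : x i != 0 -> exists k (l : 'I_3),
  cross x (fun m => (m == k)%:R) l != 0.
Proof.
move: i; apply: forall_ord3 => xi.
- exists 1, 2; rewrite /cross /=; by rewrite mulr1 mulr0 subr0.
- exists 2, 0; rewrite /cross /=; by rewrite mulr1 mulr0 subr0.
- exists 0, 1; rewrite /cross /=; by rewrite mulr1 mulr0 subr0.
Qed.

Lemma quadratic_vanish x i (B : 'I_3 -> 'I_3 -> R) : x i != 0 ->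
  (forall u l, cross x u l != 0 -> \sum_k u k * (\sum_m u m * B m k) = 0) ->
  forall k m, B k m + B m k = 0.
Proof.
move=> xi Bu.
pose Q u := \sum_k u k * (\sum_m u m * B m k).
have Q0 u : Q u = 0.
  have [[l cl]|cu] := pselect (exists l, cross x u l != 0); first exact: Bu cl.
  have {}cu l : cross x u l = 0.
    by apply/eqP/negPn/negP => cl; apply: cu; exists l.
  (* If u is parallel to x, then u + r and u - r are not, for any r that is
     not: conclude with the parallelogram identity. *)
  have [k [l ckl]] := exists_cross_neq0 xi.
  set r := (fun m => _) in ckl.
  have crossD (s : R) : cross x (fun m => u m + s * r m) l = s * cross x r l.
    rewrite -[RHS]add0r -(cu l) /cross.
    by move: (l); apply: forall_ord3 => /=; ring.
  have Qp : Q (fun m => u m + 1 * r m) = 0.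
    by apply: (Bu _ l); rewrite crossD mul1r.
  have Qm : Q (fun m => u m + -1 * r m) = 0.
    by apply: (Bu _ l); rewrite crossD mulN1r oppr_eq0.
  have Qr : Q r = 0 by apply: (Bu _ l).
  move: Qp Qm Qr; rewrite /Q !big_ord3.
  move: (u 0) (u 1) (u 2) (r 0) (r 1) (r 2) => u0 u1 u2 r0 r1 r2.
  move: (B 0 0) (B 0 1) (B 0 2) (B 1 0) (B 1 1) (B 1 2) (B 2 0) (B 2 1) (B 2 2).
  move=> b00 b01 b02 b10 b11 b12 b20 b21 b22 h1 h2 h3.
  lra.
(* Polarization at e_k + e_m. A quadratic form determines only the symmetric part of B. *)
move=> k m; pose e (k i : 'I_3) : R := (i == k)%:R.
have Qe k' m' : Q (fun i => e k' i + e m' i) = B k' k' + B m' k' + B k' m' + B m' m'.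
  have s1 (F : 'I_3 -> R) n : \sum_i e n i * F i = F n.
    rewrite (bigD1 n)//= big1 ?addr0 /e ?eqxx ?mul1r// => j /negbTE ->.
    by rewrite mul0r.
  rewrite /Q; under eq_bigr => n _.
    under eq_bigr do rewrite mulrDl.
    rewrite big_split /= !s1 mulrDl; over.
  by rewrite big_split /= !s1; ring.
have := Qe k m; have := Qe k k; have := Qe m m; rewrite !Q0.
by move: (B k k) (B m m) (B k m) (B m k) => b1 b2 b3 b4 h1 h2 h3; lra.
Qed.

(** The hypothesis amounts to det(c, u, v) + (tr A) d = 0. At a single x it only places c on the
    line of x, so the trace is obtained under the proviso c = 0, which will come from varying x. *)
Lemma trace_frame (x c : 'I_3 -> R) (A : 'I_3 -> 'I_3 -> R) (d : R) :
  d != 0 -> (exists i, x i != 0) ->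
  (forall u v, det3 x u v = d ->
     det3 (fun al => c al + \sum_be x be * A be al) u v +
     det3 x (fun al => \sum_be u be * A be al) v +
     det3 x u (fun al => \sum_be v be * A be al) = 0) ->
  (forall i, cross x c i = 0) /\ (c =1 (fun=> 0) -> \sum_i A i i = 0).
Proof.
move=> d0 [i xi] hA.
have {}hA u v : det3 x u v = d -> det3 c u v + (\sum_i A i i) * d = 0.
  move=> xuv; rewrite -xuv -[RHS](hA u v xuv) /det3 /= !big_ord3.
  move: (u 0) (u 1) (u 2) (v 0) (v 1) (v 2) => u0 u1 u2 v0 v1 v2.
  move: (x 0) (x 1) (x 2) (c 0) (c 1) (c 2) => x0 x1 x2 c0 c1 c2.
  move: (A 0 0) (A 0 1) (A 0 2) (A 1 0) (A 1 1) (A 1 2) (A 2 0) (A 2 1) (A 2 2).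
  by move=> *; ring.
have cx u l : cross x u l != 0 -> det3 c u x = 0.
  move=> /(complete_frame d)[v xuv].
  have xuv' : det3 x u (fun k => v k + x k) = d by rewrite -xuv /det3; ring.
  have := hA _ _ xuv'; rewrite (_ : det3 c u _ = det3 c u v + det3 c u x).
    by rewrite addrAC (hA _ _ xuv) add0r.
  by rewrite /det3; ring.
split.
  have ce k : det3 c (fun m => (m == k)%:R) x = 0.
    have [[l cl]|cu] := pselect (exists l, cross x (fun m => (m == k)%:R) l != 0).
      exact: cx cl.
    have {}cu l : cross x (fun m => (m == k)%:R) l = 0.
      by apply/eqP/negPn/negP => cl; apply: cu; exists l.
    have -> : det3 c (fun m => (m == k)%:R) x =
      - \sum_i c i * cross x (fun m => (m == k)%:R) i.
      by rewrite big_ord3 /det3 /cross /=; ring.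
    by rewrite big1 ?oppr0// => l _; rewrite cu mulr0.
  by apply: forall_ord3; rewrite /cross /=;
    [apply: etrans (ce 0)|apply: etrans (ce 1)|apply: etrans (ce 2)]; rewrite /det3 /=; ring.
move=> c0; have [k [l /(complete_frame d)[v xv]]] := exists_cross_neq0 xi.
have := hA _ _ xv; rewrite /det3 !c0 !mulr0 subr0 !addr0 add0r => /eqP.
by rewrite mulf_eq0 (negbTE d0) orbF => /eqP.
Qed.

End Frames.

Section LinearFields.
Variable R : realType.

Lemma mulmx_continuous n m (A : 'M[R]_(n, m)) : continuous (fun th : 'rV[R]_n => th *m A).
Proof.
have -> : (fun th : 'rV[R]_n => th *m A) = (fun th => \sum_i th 0 i *: row i A).
  by apply/funext => th; rewrite mulmx_sum_row.
elim: (index_enum _) => [|i s ih] th.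
  under [X in _ X]eq_fun do rewrite big_nil.
  exact: cst_continuous.
under [X in _ X]eq_fun do rewrite big_cons.
have c : {for th, continuous (fun th : 'rV[R]_n => th 0 i *: row i A)}.
  apply: (@continuous_comp _ _ _ (fun th : 'rV[R]_n => th 0 i) (fun t : R => t *: row i A)).
    exact: coord_continuous.
  exact: scalel_continuous.
exact: (cvgD c (ih th)).
Qed.

Lemma traceless_Y (A : 'M[R]_3) : \tr A = 0 ->
  exists c : 'I_8 -> R, forall th : 'rV[R]_3, th *m A = \sum_(k < 8) c k *: Y k th.
Proof.
move=> trA.
(* With row vectors [A i j] is the coefficient of th_i d/dth_j; the first two diagonal entries go to
   Y_1 and Y_2, and the trace fixes the third. *)
exists (fun k => nth 0 [:: A 0 0; A 1 1; A 1 0; A 2 0; A 0 1; A 2 1; A 0 2; A 1 2] k).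
move=> th; apply/rowP; move: trA; rewrite /mxtrace !big_ord3 => trA.
have A22 : A 2 2 = - A 0 0 - A 1 1 by apply/eqP; rewrite -subr_eq0 -trA; apply/eqP; ring.
apply: forall_ord3; rewrite !big_ord_recl big_ord0 !mxE /= !big_ord3 /Y /vec3 /= ?A22; ring.
Qed.

Lemma Y_traceless (c : 'I_8 -> R) : exists A : 'M[R]_3, \tr A = 0 /\
  forall th : 'rV[R]_3, th *m A = \sum_(k < 8) c k *: Y k th.
Proof.
(* Indexing by natural numbers makes the terms of the unrolled sum convertible to [d0], ...,
   [d7]. *)
pose d i : R := c (inord i).
pose d0 := d 0%N; pose d1 := d 1%N; pose d2 := d 2%N; pose d3 := d 3%N.
pose d4 := d 4%N; pose d5 := d 5%N; pose d6 := d 6%N; pose d7 := d 7%N.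
exists (\matrix_(i, j) nth 0 (nth [::]
  [:: [:: d0; d4; d6]; [:: d2; d1; d7]; [:: d3; d5; - d0 - d1]] i) j).
split; first by rewrite /mxtrace big_ord3 !mxE /=; ring.
move=> th; apply/rowP.
have -> : \sum_(k < 8) c k *: Y k th = \sum_(k < 8) d k *: Y k th.
  by apply: eq_bigr => k _; rewrite /d inord_val.
by apply: forall_ord3; rewrite !big_ord_recl big_ord0 !mxE /= !big_ord3 !mxE
  /Y /vec3 /=; rewrite -/d0 -/d1 -/d2 -/d3 -/d4 -/d5 -/d6 -/d7; ring.
Qed.

End LinearFields.

(** * Infinitesimal symmetries *)

Section DepSymmetries.
Variables (R : realType) (D : set 'rV[R]_2).
Variables a b h a'' b'' f : 'rV[R]_2 -> R.
Variables (M : set (total_space R)) (X : total_space R -> total_space R).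
Hypothesis f_neq0 : forall w, D w -> f w != 0.
Hypothesis oM : open M.
Hypothesis MD : M `<=` D `*` setT.
Let Delta := system a b h a'' b'' f.

(** Second-order coordinates are solved from the lower ones; those of order above two do not enter
    the system and are set to 0. *)
Definition solution_jet (w : 'rV[R]_2) (x p q : 'I_3 -> R) : jet R :=
  Jet w (fun al k l => match k, l with
    | 0%N, 0%N => x al
    | 1%N, 0%N => p al
    | 0%N, 1%N => q al
    | 2%N, 0%N => a w * p al + b w * q al
    | 1%N, 1%N => h w * x al
    | 0%N, 2%N => a'' w * p al + b'' w * q al
    | _, _ => 0 end).

Lemma solution_jetP w x p q : det3 x p q = f w ->
  forall nu, Delta nu (solution_jet w x p q) = 0.
Proof.
move=> xpq [al|al|al|]; rewrite /Delta ?system_det /= ?subrr//.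
by apply/eqP; rewrite subr_eq0 -xpq.
Qed.

Lemma jpoint_solution_jet (p : total_space R) u v :
  jpoint (solution_jet p.1 (fun i => p.2 0 i) u v) = p.
Proof. by case: p => w th; congr pair; apply/rowP => i; rewrite mxE. Qed.

(** * Symmetries are traceless linear fields *)

Section Forward.
Variable Phi : 'rV[R]_3 -> 'rV[R]_3.
Hypothesis XE : forall p, M p -> X p = (0, Phi p.2).
Hypothesis symX : inf_symmetry 2 Delta M X.

Let S := snd @` M.

Lemma smooth_component al : smooth S (component Phi al).
Proof.
move=> k; have oS : open S by exact: snd_open.
apply: (Ck_coord (F := Phi)) => //; exact: Ck_snd oM XE (symX.1 k).
Qed.

Lemma derivable_component al be th : S th ->
  derivable (component Phi al) th (delta_mx 0 be).
Proof. by have [_ d _] := smooth_component al 1 => Sth; exact: d. Qed.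

Lemma derivable_partial al be ga th : S th ->
  derivable (partial Phi be al) th (delta_mx 0 ga).
Proof.
by have [_ _ /(_ (delta_mx 0 be))[_ d _]] := smooth_component al 2 => Sth; exact: d.
Qed.

Lemma continuous_partial2 al be ga th : S th ->
  {for th, continuous ('D_(delta_mx 0 ga) (partial Phi be al))}.
Proof.
have [_ _ /(_ (delta_mx 0 be))[_ _ /(_ (delta_mx 0 ga)) c]] := smooth_component al 2.
by move=> Sth; exact: c.
Qed.

Let dPhi p (Mp : M p) be al ga : derivable (partial Phi be al) p.2 (delta_mx 0 ga).
Proof. by apply: derivable_partial; exists p. Qed.

Lemma hessian_antisym_neq0 th al be ga : S th -> (exists i, th 0 i != 0) ->
  'D_(delta_mx 0 ga) (partial Phi be al) th +
  'D_(delta_mx 0 be) (partial Phi ga al) th = 0.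
Proof.
move=> [p Mp <-] [i thi].
apply: (quadratic_vanish (x := fun i => p.2 0 i)
  (B := fun be ga => 'D_(delta_mx 0 ga) (partial Phi be al) p.2) thi).
move=> u l /(complete_frame (f p.1))[v uv].
pose j := solution_jet p.1 (fun i => p.2 0 i) u v.
have jp : jpoint j = p := jpoint_solution_jet p u v.
have Mj : M (jpoint j) by rewrite jp.
have sol := solution_jetP uv.
have jp2 : dep_coord j = p.2 := congr1 snd jp.
have := prolong_Euu oM XE dPhi al Mj sol; rewrite jp2 /hessian => /esym huu.
exact: etrans huu (symX.2 j Mj sol (Euu al)).
Qed.

(** Gives nonzero points tending to th, through which conditions proved away from the origin are
    carried over to th = 0. *)
Lemma near_neq0 (th : 'rV[R]_3) : exists i, \forall t \near (0 : R)^',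
  (th + t *: delta_mx 0 i) 0 i != 0.
Proof.
have [th0|th0] := eqVneq (th 0 0) 0; exists 0; near=> t; rewrite !mxE !eqxx mulr1.
  by rewrite th0 add0r; near: t; exact: nbhs_dnbhs_neq.
have tth : `|t| < `|th 0 0| by near: t; apply: dnbhs0_lt; rewrite normr_gt0.
apply/eqP => /eqP; rewrite addrC addr_eq0 => /eqP tE.
by move: tth; rewrite tE normrN ltxx.
Unshelve. all: by end_near. Qed.

Lemma hessian_antisym th al be ga : S th ->
  'D_(delta_mx 0 ga) (partial Phi be al) th +
  'D_(delta_mx 0 be) (partial Phi ga al) th = 0.
Proof.
move=> Sth; pose g y := 'D_(delta_mx 0 ga) (partial Phi be al) y +
  'D_(delta_mx 0 be) (partial Phi ga al) y.
have [i thi] := near_neq0 th.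
have cg : g @ th --> g th.
  have c1 : 'D_(delta_mx 0 ga) (partial Phi be al) @ th -->
    'D_(delta_mx 0 ga) (partial Phi be al) th by exact: continuous_partial2.
  have c2 : 'D_(delta_mx 0 be) (partial Phi ga al) @ th -->
    'D_(delta_mx 0 be) (partial Phi ga al) th by exact: continuous_partial2.
  exact: cvgD c1 c2.
have line : t *: delta_mx 0 i + th @[t --> (0 : R)^'] --> th.
  by apply: cvg_within_filter; exact: cvg_line.
have h1 : g (t *: delta_mx 0 i + th) @[t --> (0 : R)^'] --> g th.
  exact: (cvg_comp (fun t : R => t *: delta_mx 0 i + th) g line cg).
apply: (cvg_unique _ h1) => //; apply: cvg_near_cst.
have oS : open S by exact: snd_open.
near=> t; apply: hessian_antisym_neq0.
  by near: t; apply: cvg_within; exact: near_line.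
by exists i; rewrite addrC; near: t.
Unshelve. all: by end_near. Qed.

(** The case be = ga of [hessian_antisym] kills the pure second derivatives near th, so the mixed
    ones commute by [derive_comm_pure0]; being also antisymmetric, they vanish. *)
Lemma hessian0 th al be ga : S th ->
  is_derive th (delta_mx 0 ga) (partial Phi be al) 0.
Proof.
move=> Sth; have oS : open S by exact: snd_open.
have dd : 'D_(delta_mx 0 ga) (partial Phi be al) th =
    'D_(delta_mx 0 be) (partial Phi ga al) th.
  apply: derive_comm_pure0.
  apply: filterS (open_nbhs_nbhs (conj oS Sth)) => y Sy k.
  split; first exact: derivable_component.
  have d := derivableP (@derivable_partial al k k y Sy).
  apply: (is_derive_eq d).
  by have /eqP := @hessian_antisym y al k k Sy; rewrite -mulr2n mulrn_eq0 => /eqP.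
have d := derivableP (@derivable_partial al be ga th Sth).
apply: (is_derive_eq d).
by have /eqP := @hessian_antisym th al be ga Sth; rewrite -dd -mulr2n mulrn_eq0 => /eqP.
Qed.

Lemma trace_condition th : S th -> (exists i, th 0 i != 0) ->
  let c al := component Phi al th - \sum_be th 0 be * partial Phi be al th in
  (forall i, cross (fun i => th 0 i) c i = 0) /\
  (c =1 (fun=> 0) -> \sum_i partial Phi i i th = 0).
Proof.
move=> [p Mp <-] thi c; have fp := f_neq0 (MD Mp).1.
apply: (@trace_frame R (fun i => p.2 0 i) c
  (fun be al => partial Phi be al p.2) _ fp thi) => u v uv.
pose j := solution_jet p.1 (fun i => p.2 0 i) u v.
have jp : jpoint j = p := jpoint_solution_jet p u v.
have Mj : M (jpoint j) by rewrite jp.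
have sol := solution_jetP uv.
have jp2 : dep_coord j = p.2 := congr1 snd jp.
have := prolong_Edet oM XE dPhi a b h a'' b'' f Mj; rewrite jp2 => /esym hd.
apply: etrans (etrans hd (symX.2 j Mj sol Edet)); congr (det3 _ _ _ + _ + _).
by apply/funext => al; rewrite /c subrK.
Qed.

Let offset y al := component Phi al y - \sum_be y 0 be * partial Phi be al y.

(** On a ball around th the component is affine, and [offset] is its constant term, the same
    whichever point of the ball serves as base. *)
Lemma near_partial_offset th : S th -> \forall y \near th, S y /\
  (forall be al, partial Phi be al y = partial Phi be al th) /\
  (forall al, offset y al = offset th al).
Proof.
move=> Sth; have oS : open S by exact: snd_open.
have /nbhs_ballP[r /= r0 rS] : nbhs th S by exact: open_nbhs_nbhs.
apply/nbhs_ballP; exists r => //= y ry.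
have py be al : partial Phi be al y = partial Phi be al th.
  by apply: (@partials0_cst R 3 _ th r) => // z rz ga; exact/hessian0/rS.
do 2![split; first by [exact: rS|exact: py]] => al.
have fy : component Phi al y = component Phi al th +
    \sum_i (y 0 i - th 0 i) * partial Phi i al th.
  apply: (@partial2_affine R 3 (component Phi al) th r) => // z rz i.
    exact/derivable_component/rS.
  by move=> k; exact/hessian0/rS.
rewrite /offset fy; under [X in _ - X]eq_bigr do rewrite py.
rewrite -addrA -sumrB; congr (_ + _); rewrite -sumrN.
by apply: eq_bigr => i _; rewrite mulrBl addrC addKr.
Qed.

Lemma offset0 th al : S th -> offset th al = 0.
Proof.
move=> Sth; have /nbhs_ballP[r /= r0 rS] := near_partial_offset Sth.
have cr y k : ball th r y -> cross (fun i => y 0 i) (offset th) k = 0.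
  move=> /rS[Sy [_ oy]]; have -> : offset th = offset y by apply/funext => ?; rewrite oy.
  have [[i yi]|y0] := pselect (exists i, y 0 i != 0).
    by have [cy _] := trace_condition Sy (ex_intro _ i yi); exact: cy.
  have {}y0 i : y 0 i = 0 by apply/eqP/negPn/negP => yi; apply: y0; exists i.
  by move: k; apply: forall_ord3; rewrite /cross /= !y0 !mul0r subrr.
(* The cross product is linear in its first argument: subtracting the relation at th from the one at
   th + (r / 2) e_i leaves the relation at e_i. Half the radius keeps the point in the ball. *)
have ce i k : cross (fun m => (m == i)%:R) (offset th) k = 0.
  have r2 : r / 2 != 0 by rewrite mulf_neq0 ?gt_eqF// invr_eq0.
  apply: (mulfI r2); rewrite mulr0.
  have bth : ball th r th by exact: ballxx.
  have b1 : ball th r (th + (r / 2) *: delta_mx 0 i).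
    apply/ball_rowP => // m; rewrite !mxE opprD addrA subrr sub0r normrN.
    case: (m == i); rewrite ?andbF ?mulr0 ?normr0//= mulr1 ger0_norm ?divr_ge0 ?ltW//.
    by rewrite ltr_pdivrMr// ltr_pMr// ltr1n.
  have -> : r / 2 * cross (fun m => (m == i)%:R) (offset th) k =
      cross (fun m => (th + (r / 2) *: delta_mx 0 i) 0 m) (offset th) k
      - cross (fun m => th 0 m) (offset th) k.
    move: k {cr}; rewrite /cross; apply: forall_ord3 => /=; rewrite !mxE /=;
    move: (offset th 0) (offset th 1) (offset th 2) => c0 c1 c2; ring.
  by rewrite !cr// subrr.
move: al; apply: forall_ord3.
- by have := ce 1 2; rewrite /cross /= mul0r mul1r sub0r => /eqP; rewrite oppr_eq0 => /eqP.
- by have := ce 0 2; rewrite /cross /= mul0r mul1r subr0.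
- by have := ce 0 1; rewrite /cross /= mul0r mul1r sub0r => /eqP; rewrite oppr_eq0 => /eqP.
Qed.

(** [trace_condition] excludes the origin, so it is applied at a nearby nonzero point with the same
    partial derivatives. *)
Lemma trace0 th : S th -> \sum_i partial Phi i i th = 0.
Proof.
move=> Sth; have [i thi] := near_neq0 th; have np := near_partial_offset Sth.
have c : t *: (delta_mx 0 i : 'rV[R]_3) + th @[t --> (0 : R)^'] --> th.
  by apply: cvg_within_filter; exact: cvg_line.
have [t [ti [Sy [py oy]]]] := filter_ex (filterI thi (c _ np)).
set y := t *: _ + th in Sy py oy.
have yi : exists i, y 0 i != 0 by exists i; rewrite /y addrC.
have [_ tr_y] := trace_condition Sy yi.
by apply: etrans (tr_y (fun al => offset0 al Sy)); apply: eq_bigr => k _; rewrite py.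
Qed.

(** A vanishing offset is Euler's identity, so Phi(th) is th times its matrix of partial
    derivatives; this matrix is locally constant, hence constant on the connected S. *)
Lemma dep_field_linear : M !=set0 -> connected S ->
  exists A : 'M[R]_3, \tr A = 0 /\ forall p, M p -> X p = (0, p.2 *m A).
Proof.
move=> [p0 Mp0] cS; have oS : open S by exact: snd_open.
have S0 : S p0.2 by exists p0.
exists (\matrix_(i, j) partial Phi i j p0.2); split.
  by apply: etrans (trace0 S0); apply: eq_bigr => i _; rewrite mxE.
move=> p Mp; rewrite XE//; congr pair; have Sp : S p.2 by exists p.
apply/rowP => al; rewrite mxE -[LHS]/(component Phi al p.2).
have /eqP := offset0 al Sp; rewrite subr_eq0 => /eqP ->.
apply: eq_bigr => be _; rewrite mxE; congr (_ * _).
apply: (@connected_locally_cst _ _ S (partial Phi be al)) => // th Sth.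
by apply: filterS (near_partial_offset Sth) => y [_ [py _]].
Qed.

End Forward.

Lemma dep_inf_symmetry_linear : M !=set0 -> connected (snd @` M) ->
  dep_inf_symmetry 2 Delta M X ->
  exists A : 'M[R]_3, \tr A = 0 /\ forall p, M p -> X p = (0, p.2 *m A).
Proof. by move=> M0 cM [symX [Phi XE]]; exact: (dep_field_linear XE symX). Qed.

End DepSymmetries.

(** * Traceless linear fields are symmetries *)

Section Converse.
Variables (R : realType).
Variables a b h a'' b'' f : 'rV[R]_2 -> R.
Variables (M : set (total_space R)) (X : total_space R -> total_space R).
Variable A : 'M[R]_3.
Hypothesis oM : open M.
Hypothesis trA : \tr A = 0.
Hypothesis XE : forall p, M p -> X p = (0, p.2 *m A).

Let Phi (th : 'rV[R]_3) := th *m A.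

Let partialE be al : partial Phi be al = cst (A be al).
Proof.
apply/funext => th; suff : is_derive th (delta_mx 0 be) (component Phi al) (A be al).
  by case.
apply: is_derive_affine => t; rewrite /component /Phi mulmxDl mxE.
by congr (_ + _); rewrite -scalemxAl -rowE !mxE.
Qed.

Lemma linear_inf_symmetry : dep_inf_symmetry 2 (system a b h a'' b'' f) M X.
Proof.
split; last by exists Phi.
have dPhi p (Mp : M p) be al ga : derivable (partial Phi be al) p.2 (delta_mx 0 ga).
  by rewrite partialE; exact: derivable_cst.
have hess al th u v : hessian Phi al th u v = 0.
  rewrite /hessian big1// => ga _; rewrite big1 ?mulr0// => be _.
  by rewrite partialE derive_cst mulr0.
have tanE al th u : tangent Phi al th u = \sum_be u be * A be al.
  by apply: eq_bigr => be _; rewrite partialE.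
split.
  move=> k; apply: (@Ck_ext R _ _ M (fun p => (0, p.2 *m A))) => //.
    by move=> p Mp; rewrite XE.
  apply: smooth_linear => [c p q|p].
    by congr pair; rewrite /= ?scaler0 ?addr0// mulmxDl scalemxAl.
  have c1 : (fun=> 0 : 'rV[R]_2) @ p --> (0 : 'rV[R]_2) by exact: cvg_cst.
  have c2 : (fun q : total_space R => q.2 *m A) @ p --> p.2 *m A.
    exact: (cvg_comp snd (fun th : 'rV[R]_3 => th *m A) (@snd_cvg R _ _ p)
      (@mulmx_continuous R 3 3 A p.2)).
  exact: (cvg_pair c1 c2).
move=> j Mj sol [al|al|al|].
- by rewrite (prolong_Euu oM XE dPhi al Mj sol) hess.
- rewrite (prolong_Euv oM XE dPhi al Mj sol) hess add0r tanE.
  rewrite (_ : component _ _ _ = \sum_be jvec j 0 0 be * A be al) ?subrr ?mulr0//.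
  by rewrite /component /Phi mxE; apply: eq_bigr => be _; rewrite /dep_coord mxE.
- by rewrite (prolong_Evv oM XE dPhi al Mj sol) hess.
- rewrite (prolong_Edet oM XE dPhi a b h a'' b'' f Mj).
  have -> : (component Phi)^~ (dep_coord j) = fun al => \sum_be jvec j 0 0 be * A be al.
    apply/funext => al.
    by rewrite /component /Phi mxE; apply: eq_bigr => be _; rewrite /dep_coord mxE.
  have tE k l : (fun al => tangent Phi al (dep_coord j) (jvec j k l)) =
      fun al => \sum_be jvec j k l be * A be al by apply/funext => al.
  (* Applying A to one column at a time and summing multiplies the determinant by tr A. *)
  rewrite !tE; apply: (@etrans _ _ (\tr A * det3 (jvec j 0 0) (jvec j 1 0) (jvec j 0 1))).
    rewrite /det3 /mxtrace /= !big_ord3.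
    move: (jvec j 0 0 0) (jvec j 0 0 1) (jvec j 0 0 2) => x0 x1 x2.
    move: (jvec j 1 0 0) (jvec j 1 0 1) (jvec j 1 0 2) => u0 u1 u2.
    move: (jvec j 0 1 0) (jvec j 0 1 1) (jvec j 0 1 2) => v0 v1 v2.
    move: (A 0 0) (A 0 1) (A 0 2) (A 1 0) (A 1 1) (A 1 2) (A 2 0) (A 2 1) (A 2 2).
    by move=> *; ring.
  by rewrite trA mul0r.
Qed.

End Converse.

(** * The group generated by the symmetries *)

Section LinearODE.
Variable R : realType.

Lemma det_mx3 (A : 'M[R]_3) :
  \det A = det3 (fun j => A 0 j) (fun j => A 1 j) (fun j => A 2 j).
Proof.
pose a i j := A (inord i) (inord j).
have aE i j : A i j = a i j by rewrite /a !inord_val.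
rewrite /det3 !aE (expand_det_row _ 0) !big_ord_recl big_ord0 /cofactor.
rewrite !(expand_det_row _ 0) !big_ord_recl !big_ord0 /cofactor !det_mx11 !mxE.
by rewrite !aE /= /bump /= !add0n; ring.
Qed.

(** Stated by coordinates because it serves to differentiate determinants; the time interval is that
    of [flows_to]. *)
Definition linear_solution n (B : 'M[R]_n) (y : R -> 'rV[R]_n) :=
  forall t : R, 0 <= t <= 1 -> forall j,
    is_derive t 1 (fun s => y s 0 j) ((y t *m B) 0 j).

Lemma linear_solutionD n (B : 'M[R]_n) y z (c : R) :
  linear_solution B y -> linear_solution B z ->
  linear_solution B (fun t => y t + c *: z t).
Proof.
move=> sy sz t t01 j.
have d := is_deriveD (sy t t01 j) (is_deriveZ c (sz t t01 j)).
have -> : (fun s => (y s + c *: z s) 0 j) =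
    (fun s => y s 0 j) + c \*: (fun s => z s 0 j).
  by apply/funext => s; rewrite !mxE.
apply: (is_derive_eq d).
by rewrite mulmxDl -scalemxAl [RHS]mxE; congr (_ + _); rewrite [RHS]mxE.
Qed.

(** Liouville's formula: the derivative of the determinant is tr B times the determinant. *)
Lemma det3_linear_solution (B : 'M[R]_3) (x y z : R -> 'rV[R]_3) : \tr B = 0 ->
  linear_solution B x -> linear_solution B y -> linear_solution B z ->
  det3 (x 1 0) (y 1 0) (z 1 0) = det3 (x 0 0) (y 0 0) (z 0 0).
Proof.
move=> trB sx sy sz.
apply: (@is_derive_segment_cst R (fun t => det3 (x t 0) (y t 0) (z t 0)) 0 1) => //.
move=> t t01.
have dx := sx t t01; have dy := sy t t01; have dz := sz t t01.
pose m2 i j := is_deriveB (is_deriveM (dy i) (dz j)) (is_deriveM (dy j) (dz i)).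
have d := is_deriveD (is_deriveB (is_deriveM (m2 1 2) (dx 0))
  (is_deriveM (m2 0 2) (dx 1))) (is_deriveM (m2 0 1) (dx 2)).
apply: (is_derive_eq d).
apply: (@etrans _ _ (\tr B * det3 (x t 0) (y t 0) (z t 0))); last by rewrite trB mul0r.
rewrite /det3 /mxtrace !fctE /= !mxE !big_ord3 /=.
move: (x t 0 0) (x t 0 1) (x t 0 2) (y t 0 0) (y t 0 1) (y t 0 2).
move: (z t 0 0) (z t 0 1) (z t 0 2) (B 0 0) (B 0 1) (B 0 2) (B 1 0) (B 1 1).
move: (B 1 2) (B 2 0) (B 2 1) (B 2 2) => *.
have sE (r s : R) : r *: s = r * s by [].
by rewrite !sE; ring.
Qed.

(* By Cramer's rule the coordinates of y in the basis e are determinants of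
   solutions, hence constant. *)
Lemma linear_solution_basis (B : 'M[R]_3) (e : 'I_3 -> R -> 'rV[R]_3) y :
  \tr B = 0 -> (forall i, linear_solution B (e i)) -> linear_solution B y ->
  \det (\matrix_i e i 0) = 1 -> y 0 = 0 -> y 1 = 0.
Proof.
move=> trB se sy; rewrite det_mx3.
have rE t i : (fun j => (\matrix_i e i t) i j) = e i t 0.
  by apply/funext => j; rewrite mxE.
rewrite !rE => det1 y0.
have d1 := det3_linear_solution trB (se 0) (se 1) (se 2).
have h0 := det3_linear_solution trB sy (se 1) (se 2).
have h1 := det3_linear_solution trB (se 0) sy (se 2).
have h2 := det3_linear_solution trB (se 0) (se 1) sy.
have z0 : y 0 0 = fun=> 0 by apply/funext => j; rewrite y0 mxE.
rewrite det1 in d1.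
have {}h0 : det3 (y 1 0) (e 1 1 0) (e 2 1 0) = 0.
  by rewrite h0 /det3 z0 /= !(mulr0, mul0r, subr0, addr0).
have {}h1 : det3 (e 0 1 0) (y 1 0) (e 2 1 0) = 0.
  by rewrite h1 /det3 z0 /= !(mulr0, mul0r, subr0, addr0).
have {}h2 : det3 (e 0 1 0) (e 1 1 0) (y 1 0) = 0.
  by rewrite h2 /det3 z0 /= !(mulr0, mul0r, subr0, addr0).
apply/rowP => k; rewrite [RHS]mxE.
apply: (@etrans _ _ (y 1 0 k * det3 (e 0 1 0) (e 1 1 0) (e 2 1 0))).
  by rewrite d1 mulr1.
apply: (@etrans _ _ (e 0 1 0 k * det3 (y 1 0) (e 1 1 0) (e 2 1 0) +
  e 1 1 0 k * det3 (e 0 1 0) (y 1 0) (e 2 1 0) +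
  e 2 1 0 k * det3 (e 0 1 0) (e 1 1 0) (y 1 0))); last first.
  by rewrite h0 h1 h2 !mulr0 !addr0.
move: k; apply: forall_ord3; rewrite /det3 /=;
move: (y 1 0 0) (y 1 0 1) (y 1 0 2) (e 0 1 0 0) (e 0 1 0 1) (e 0 1 0 2);
move: (e 1 1 0 0) (e 1 1 0 1) (e 1 1 0 2) (e 2 1 0 0) (e 2 1 0 1) (e 2 1 0 2);
by move=> *; ring.
Qed.

Lemma is_derive_pair (V V' W : normedModType R) (g : V -> V' * W) x v d :
  is_derive x v g d ->
  is_derive x v (fst \o g) d.1 /\ is_derive x v (snd \o g) d.2.
Proof.
move=> [dg <-].
pose q (k : R) := k^-1 *: ((g \o shift x) (k *: v) - g x).
have c1 : fst \o q @ 0^' --> ('D_v g x).1.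
  exact: (cvg_comp q fst dg (@fst_cvg _ _ _ _)).
have c2 : snd \o q @ 0^' --> ('D_v g x).2.
  exact: (cvg_comp q snd dg (@snd_cvg _ _ _ _)).
split; split.
- by apply/cvg_ex; exists ('D_v g x).1.
- exact: cvg_lim c1.
- by apply/cvg_ex; exists ('D_v g x).2.
- exact: cvg_lim c2.
Qed.

Lemma is_derive_mx_coord (V : normedModType R) n (g : V -> 'rV[R]_n) x v d j :
  is_derive x v g d -> is_derive x v (fun y => g y 0 j) (d 0 j).
Proof.
move=> [dg <-]; split; first by have /derivable_mxP := dg.
by rewrite (derive_mx dg) mxE.
Qed.

Lemma flows_to_dep n m (M : set ('rV[R]_n * 'rV[R]_m)) X (B : 'M[R]_m) p q :
  (forall p, M p -> X p = (0, p.2 *m B)) -> flows_to M X p q ->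
  q.1 = p.1 /\ exists y, [/\ linear_solution B y, y 0 = p.2 & y 1 = q.2].
Proof.
move=> XE [g [<- <- dg]]; split.
  apply/rowP => j; apply: (@is_derive_segment_cst R (fun t => (g t).1 0 j)) => //.
  move=> t /dg[Mt /is_derive_pair[/is_derive_mx_coord d _]].
  by apply: (is_derive_eq (d j)); rewrite XE//= mxE.
exists (fun t => (g t).2); split => // t /dg[Mt /is_derive_pair[_ d]] j.
by apply: (is_derive_eq (is_derive_mx_coord j d)); rewrite XE.
Qed.

End LinearODE.

(** * Compositions of flows and unimodular matrices *)

Section Generated.
Variable R : realType.

Lemma generated_ext (V : normedModType R) (L : (V -> V) -> Prop) (M U : set V) g g' :
  generated L M U g -> (forall p, U p -> g p = g' p) -> generated L M U g'.
Proof.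
case=> [g0 oU UM g0E|X g0 g1 LX gen fl] gE.
  by apply: generated_id => // p Up; rewrite -gE// g0E.
by apply: (generated_exp LX gen) => p Up; rewrite -gE//; exact: fl.
Qed.

(** The space is the union of the lines through 0. *)
Lemma connected_setT (V : normedModType R) : connected [set: V].
Proof.
pose line (v : V) := (fun t : R => t *: v) @` setT.
have -> : [set: V] = \bigcup_(v in setT) line v.
  apply/seteqP; split => // v _; exists v => //; exists 1 => //.
  by rewrite scale1r.
apply: bigcup_connected; first by exists 0 => v _; exists 0; rewrite ?scale0r.
move=> v _; apply: connected_continuous_connected.
  by apply/connected_intervalP.
by apply: continuous_subspaceT; exact: scalel_continuous.
Qed.

Variables (D : set 'rV[R]_2) (a b h a'' b'' f : 'rV[R]_2 -> R).
Hypothesis oD : open D.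
Hypothesis f_neq0 : forall w, D w -> f w != 0.
Let M : set (total_space R) := D `*` setT.
Let L := dep_inf_symmetry 2 (system a b h a'' b'' f) M.

Let oM : open M.
Proof.
move=> [w th] [Dw _]; exists (D, setT) => //=; split; last exact: filterT.
exact: open_nbhs_nbhs.
Qed.

Lemma generated_transvection_product U (A : 'M[R]_3) : open U -> U `<=` M ->
  transvection_product A -> generated L M U (fun p => (p.1, p.2 *m A)).
Proof.
move=> oU UM; elim => [|B i j s _ ih ij].
  by apply: generated_id => // -[w th] _; rewrite mulmx1.
pose N : 'M[R]_3 := s *: delta_mx i j.
(* Hence the integral curve from q is the segment q + t q N, which ends at q (1 + N), the image of q
   under the transvection. *)
have NN : N *m N = 0.
  rewrite /N -scalemxAl -scalemxAr mul_delta_mx_cond eq_sym (negbTE ij).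
  by rewrite mulr0n !scaler0.
have trN : \tr N = 0.
  rewrite /N mxtraceZ /mxtrace big1 ?mulr0// => k _; rewrite mxE.
  by case: eqP => [->|//]; rewrite (negbTE ij).
pose X (p : total_space R) : total_space R := (0, p.2 *m N).
have LX : L X by apply: (linear_inf_symmetry _ _ _ _ _ _ oM trN).
apply: (generated_exp LX ih) => p Up.
pose d : total_space R := (0, p.2 *m B *m N).
have sndE (t : R) : ((p.1, p.2 *m B) + t *: d).2 = p.2 *m B + t *: (p.2 *m B *m N).
  by [].
exists (fun t : R => (p.1, p.2 *m B) + t *: d); split.
- by rewrite scale0r addr0.
- rewrite scale1r; congr pair; first by rewrite /= addr0.
  by rewrite /= /transvection mulmxA mulmxDr mulmx1.
- move=> t _; split; first by split=> //=; rewrite scaler0 addr0; have [] := UM p Up.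
  have -> : X ((p.1, p.2 *m B) + t *: d) = d.
    by congr pair; rewrite sndE mulmxDl -scalemxAl -(mulmxA _ N N) NN mulmx0 scaler0 addr0.
  apply: is_derive_affine => u.
  by rewrite [u *: 1]mulr1 scalerDl addrA.
Qed.

(** The rows of E are the time-one values of solutions starting at the rows of A. A curve from p.2 A
    and the matching combination of these solutions start together, so they end together. The field
    has one matrix B on all of M, so one E serves every point of U, connected or not. *)
Lemma flows_to_unimodular U (X : total_space R -> total_space R) (A : 'M[R]_3) g :
  open U -> U `<=` M -> L X -> \det A = 1 ->
  (forall p, U p -> flows_to M X (p.1, p.2 *m A) (g p)) ->
  exists E : 'M[R]_3, \det E = 1 /\ forall p, U p -> g p = (p.1, p.2 *m E).
Proof.
move=> oU UM LX detA fl.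
have [[p0 Up0]|U0] := pselect (U !=set0); last first.
  by exists 1%:M; split=> [|p Up]; [exact: det1|case: U0; exists p].
have M0 : M !=set0 by exists p0; exact: UM.
have sM : snd @` M = [set: 'rV[R]_3].
  apply/seteqP; split=> // th _; exists (p0.1, th) => //; split=> //.
  by have [] := UM _ Up0.
have cM : connected (snd @` M) by rewrite sM; exact: connected_setT.
have [B [trB XE]] := dep_inf_symmetry_linear f_neq0 oM (@subset_refl _ M) M0 cM LX.
have sol p : U p -> exists y,
    [/\ linear_solution B y, y 0 = p.2 *m A & g p = (p.1, y 1)].
  move=> Up; have [e1 [y [sy y0 y1]]] := flows_to_dep XE (fl p Up).
  by exists y; split=> //; rewrite [LHS]surjective_pairing e1 y1.
have line i : \forall t \near (0 : R)^', U (t *: (0, delta_mx 0 i) + p0).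
  exact: cvg_within (near_line (0, delta_mx 0 i) oU Up0).
have nz : \forall t \near (0 : R)^', t != 0 by exact: nbhs_dnbhs_neq.
(* A common nonzero t for the three directions keeps all the displaced points in U. *)
have [t [t0 [l0 [l1 l2]]]] := filter_ex (filterI nz (filterI (line 0)
  (filterI (line 1) (line 2)))).
have {l0 l1 l2} Ui : forall i, U (t *: (0, delta_mx 0 i) + p0).
  by apply: forall_ord3.
have [y0 [sy0 y00 _]] := sol _ Up0.
pose yc i := cid (sol _ (Ui i)).
(* Differences of the curves through p0 + t e_i and through p0 are solutions
   starting at e_i A. *)
pose e i (s : R) : 'rV[R]_3 := t^-1 *: sval (yc i) s + - t^-1 *: y0 s.
have se i : linear_solution B (e i).
  have [si _ _] := svalP (yc i).
  (* The zero solution turns [linear_solutionD] into closure under scalar multiples. *)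
  have s0 : linear_solution B (fun=> 0).
    move=> s _ j; apply: is_derive_affine => u.
    by rewrite mul0mx mxE scaler0 addr0.
  have := linear_solutionD (- t^-1) (linear_solutionD t^-1 s0 si) sy0.
  rewrite (_ : (fun s => _) = e i)//.
  by apply/funext => s; rewrite add0r.
have e0 i : e i 0 = row i A.
  have [_ yi0 _] := svalP (yc i); rewrite /e yi0 y00 /= mulmxDl scalerDr.
  by rewrite -scalemxAl scalerA mulVf// scale1r scaleNr addrK rowE.
exists (\matrix_i e i 1); split.
  have := det3_linear_solution trB (se 0) (se 1) (se 2).
  have rE (s : R) i : (fun j => (\matrix_i e i s) i j) = e i s 0.
    by apply/funext => j; rewrite mxE.
  rewrite -!rE -!det_mx3 => ->; rewrite -detA; congr (\det _).
  by apply/matrixP => i j; rewrite mxE e0 mxE.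
move=> p Up; have [y [sy y_0 ->]] := sol p Up; congr pair.
pose u s := y s + - p.2 0 0 *: e 0 s + - p.2 0 1 *: e 1 s + - p.2 0 2 *: e 2 s.
have su : linear_solution B u by do 3![apply: linear_solutionD => //].
have u0 : u 0 = 0.
  rewrite /u y_0 !e0 mulmx_sum_row big_ord3 !scaleNr.
  by rewrite -!addrA -!opprD !addrA subrr.
have u1 : u 1 = 0.
  apply: (linear_solution_basis trB se su) => //.
  by rewrite -detA; congr (\det _); apply/matrixP => i j; rewrite mxE e0 mxE.
rewrite mulmx_sum_row big_ord3 !rowK.
move: u1; rewrite /u !scaleNr -!addrA -!opprD => /eqP; rewrite subr_eq0 => /eqP.
by rewrite addrA.
Qed.

Lemma generated_unimodular U g : U `<=` M -> generated L M U g ->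
  exists E : 'M[R]_3, \det E = 1 /\ forall p, U p -> g p = (p.1, p.2 *m E).
Proof.
move=> UM; elim=> {g} [g oU _ gE|X g g' LX gen [A [detA gE]] fl].
  by exists 1%:M; split=> [|[w th] Up]; [exact: det1|rewrite gE//= mulmx1].
have oU : open U by elim: gen.
apply: (flows_to_unimodular oU UM LX detA) => p Up.
by rewrite -gE//; exact: fl.
Qed.

End Generated.

Theorem theorem4 (R : realType) (D : set 'rV[R]_2)
    (a b h a'' b'' f : 'rV[R]_2 -> R)
    (D_open : open D) (D_nonempty : D !=set0)
    (a_smooth : smooth D a) (b_smooth : smooth D b) (h_smooth : smooth D h)
    (a''_smooth : smooth D a'') (b''_smooth : smooth D b'')
    (f_smooth : smooth D f)
    (f_neq0 : forall w, D w -> f w != 0)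
    (eq1 : forall w, D w -> a w * h w = pd 0 h w)
    (eq2 : forall w, D w -> pd 1 a w = b w * a'' w + h w)
    (eq3 : forall w, D w -> pd 1 b w + b w * b'' w = 0)
    (eq4 : forall w, D w -> pd 1 h w = b'' w * h w)
    (eq5 : forall w, D w -> pd 0 a'' w + a w * a'' w = 0)
    (eq6 : forall w, D w -> h w = pd 0 b'' w + a'' w * b w) :
  (forall M : set (total_space R),
     open M -> M !=set0 -> M `<=` D `*` setT -> connected (snd @` M) ->
     forall X : total_space R -> total_space R,
       dep_inf_symmetry 2 (system a b h a'' b'' f) M X <->
       exists c : 'I_8 -> R,
         forall p, M p -> X p = (0, \sum_(k < 8) c k *: Y k p.2))
  /\
  (forall (U : set (total_space R))
          (g : total_space R -> total_space R),
     open U -> U `<=` D `*` setT ->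
     generated (dep_inf_symmetry 2 (system a b h a'' b'' f) (D `*` setT))
               (D `*` setT) U g <->
     exists T : 'rV[R]_3 -> 'rV[R]_3,
       unimodular_centroaffine T /\ forall p, U p -> g p = (p.1, T p.2)).
Proof.
split=> [M oM M0 MD cM X|U g oU UD].
  split=> [/(dep_inf_symmetry_linear f_neq0 oM MD M0 cM)[A [trA XE]]|[c XE]].
    have [c cE] := traceless_Y trA; exists c => p Mp.
    by rewrite XE// cE.
  have [A [trA AE]] := Y_traceless c.
  apply: (linear_inf_symmetry _ _ _ _ _ _ oM trA) => p Mp.
  by rewrite XE// AE.
split=> [/(generated_unimodular D_open f_neq0 UD)[E [detE gE]]|[T [[A [[uA TE] detA]] gE]]].
  exists (fun th => th *m E); split; last exact: gE.
  by exists E; split=> //; split=> //; rewrite unitmxE detE unitr1.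
have gen := generated_transvection_product a b h a'' b'' f D_open oU UD
  (transvection_product_det1 detA).
by apply: (generated_ext gen) => p Up; rewrite gE// TE.
Qed.
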